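(* Let $T_1,T_2$ be linear operators on $\bigcup_{p\ge1}L^p(\mathbb{R}^d)$, $r\in(1,3/2]$, $\beta_1,\beta_2,\gamma\in[0,\infty)$, and let $A,A_0,A_1,A_2$ be positive constants. Suppose: (i) $T_1$ is bounded on $L^{r'}(\mathbb{R}^d)$ with bound $A$; (ii) for each $\lambda>0$, $|\{x:|T_1T_2f(x)|>\lambda\}|\lesssim\int_{\mathbb{R}^d}\frac{A_0|f|}{\lambda}\log^{\beta_1}(\mathrm{e}+\frac{A_0|f|}{\lambda})dx$; (iii) for each $\lambda>0$, $|\{x:\mathscr{M}_{T_1,r'}T_2f(x)>\lambda\}|\lesssim\int_{\mathbb{R}^d}\frac{A_1|f|}{\lambda}\log^{\beta_1}(\mathrm{e}+\frac{A_1|f|}{\lambda})dx$ and $|\{x:\mathscr{M}_{T_2,r'}f(x)>\lambda\}|\lesssim\int_{\mathbb{R}^d}\frac{A_2|f|}{\lambda}\log^{\beta_2}(\mathrm{e}+\frac{A_2|f|}{\lambda})dx$. Then for every bounded function $f$ with compact support there exist a $\frac12\frac1{9^d}$-sparse family of cubes $\mathcal{S}$ and functions $H_1,H_2$ such that for every function $g$, $$\Big|\int_{\mathbb{R}^d}H_1g\Big|\lesssim(A_0+A_1)\mathcal{A}_{\mathcal{S};L(\log L)^{\beta_1},L^r}(f,g),\qquad\Big|\int_{\mathbb{R}^d}H_2g\Big|\lesssim AA_2\,\mathcal{A}_{\mathcal{S};L(\log L)^{\beta_2},L^r}(f,g),$$ and $T_1T_2f(x)=H_1(x)+H_2(x)$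 for a.e. $x\in\mathbb{R}^d$.
   Context: $r'=r/(r-1)$. For a cube $Q$, $3Q$ is the concentric cube with three times the side length. For a linear operator $T$, $\mathscr{M}_{T,s}f(x)=\sup_{Q\ni x}|Q|^{-1/s}\|T(f\chi_{\mathbb{R}^d\setminus3Q})\chi_Q\|_{L^s(\mathbb{R}^d)}$ (supremum over cubes containing $x$). For a cube $Q$, $\langle|g|\rangle_{Q,r}=(\frac1{|Q|}\int_Q|g|^r)^{1/r}$, $\|f\|_{L(\log L)^\beta,Q}=\inf\{\lambda>0:\frac1{|Q|}\int_Q\frac{|f|}{\lambda}\log^\beta(\mathrm{e}+\frac{|f|}{\lambda})\le1\}$, and $\mathcal{A}_{\mathcal{S};L(\log L)^\beta,L^r}(f,g)=\sum_{Q\in\mathcal{S}}|Q|\|f\|_{L(\log L)^\beta,Q}\langle|g|\rangle_{Q,r}$. A family $\mathcal{S}$ of cubes is $\eta$-sparse if each $Q\in\mathcal{S}$ has measurable $E_Q\subset Q$ with $|E_Q|\ge\eta|Q|$, the $E_Q$ pairwise disjoint. *)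

(* Defs.v *)
(* R^d is modelled as [d.-tuple R] with the
   library's product (Borel) sigma-algebra on tuples; Lebesgue measure on
   R^d is defined below as the iterated (Tonelli) integral of the
   one-dimensional Lebesgue measure. *)
From HB Require Import structures.
From mathcomp Require Import all_boot all_order all_algebra.
From mathcomp Require Import all_classical all_reals all_analysis.
Set Implicit Arguments. Unset Strict Implicit. Unset Printing Implicit Defensive.
Import Order.TTheory GRing.Theory Num.Theory.
Local Open Scope classical_set_scope.
Local Open Scope ring_scope.

Section Rd.
Context {R : realType}.

Fixpoint leb (d : nat) : set (d.-tuple R) -> \bar R :=
  match d with
  | 0%N => fun A => (\1_A [tuple] : R)%:E
  | n.+1 => fun A =>
      (\int[@lebesgue_measure R]_x leb [set t : n.-tuple R | A [tuple of x :: t]])%E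
  end.

Variable d : nat.
Local Notation Rd := (d.-tuple R).

Definition ae_Rd (P : Rd -> Prop) : Prop :=
  almost_everywhere (@leb d) [set x | P x].

(* A cube is given by its center c and side length l (l > 0 is required
   wherever cubes are used); sides parallel to the axes, closed. *)
Definition cube (Q : Rd * R) : set Rd :=
  [set x | forall i : 'I_d, `|tnth x i - tnth Q.1 i| <= Q.2 / 2].
Definition is_cube (Q : Rd * R) : Prop := 0 < Q.2.
Definition dil3 (Q : Rd * R) : Rd * R := (Q.1, 3 * Q.2).
Definition vol (Q : Rd * R) : R := Q.2 ^+ d.

Definition Lp (p : R) (f : Rd -> R) : Prop :=
  measurable_fun setT f /\ (\int[@leb d]_x (`|f x| `^ p)%:E < +oo)%E.
Definition Lunion (f : Rd -> R) : Prop := exists p : R, 1 <= p /\ Lp p f.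
Definition normp (p : R) (f : Rd -> R) : \bar R :=
  poweR (\int[@leb d]_x (`|f x| `^ p)%:E)%E p^-1.
Definition normp_on (p : R) (Q : Rd * R) (f : Rd -> R) : \bar R :=
  poweR (\int[@leb d]_(x in cube Q) (`|f x| `^ p)%:E)%E p^-1.

(* A linear operator on \bigcup_{p>=1} L^p(R^d) (acting on a.e.-classes,
   with values measurable functions) *)
Definition lin_op (T : (Rd -> R) -> (Rd -> R)) : Prop :=
  [/\ (forall f, Lunion f -> measurable_fun setT (T f)),
      (forall f g (a b : R), Lunion f -> Lunion g ->
         ae_Rd (fun x => T (fun y => a * f y + b * g y) x = a * T f x + b * T g x))
    & (forall f g, Lunion f -> Lunion g -> ae_Rd (fun x => f x = g x) ->
         ae_Rd (fun x => T f x = T g x))].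

Definition PhiL (beta t : R) : R := t * (ln (expR 1 + t)) `^ beta.

Definition modular (beta a lam : R) (f : Rd -> R) : \bar R :=
  (\int[@leb d]_x (PhiL beta (a * `|f x| / lam))%:E)%E.

Definition LlogL_norm (beta : R) (f : Rd -> R) (Q : Rd * R) : \bar R :=
  ereal_inf [set lam%:E | lam in [set lam : R | 0 < lam /\
     ((vol Q)^-1%:E * \int[@leb d]_(x in cube Q) (PhiL beta (`|f x| / lam))%:E
        <= 1)%E]].

Definition avg_r (r : R) (g : Rd -> R) (Q : Rd * R) : \bar R :=
  poweR ((vol Q)^-1%:E * \int[@leb d]_(x in cube Q) (`|g x| `^ r)%:E)%E r^-1.

Definition sparse_form (beta r : R) (S : set (Rd * R)) (f g : Rd -> R) : \bar R :=
  (\esum_(Q in S) ((vol Q)%:E * LlogL_norm beta f Q * avg_r r g Q))%E.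

Definition sparse (eta : R) (S : set (Rd * R)) : Prop :=
  (forall Q, S Q -> is_cube Q) /\
  exists E : Rd * R -> set Rd,
    (forall Q, S Q -> [/\ measurable (E Q), E Q `<=` cube Q
                        & ((eta * vol Q)%:E <= leb (E Q))%E]) /\
    (forall Q Q', S Q -> S Q' -> Q <> Q' -> E Q `&` E Q' = set0).

Definition Mop (T : (Rd -> R) -> (Rd -> R)) (s : R) (f : Rd -> R) (x : Rd) : \bar R :=
  ereal_sup [set (((vol Q) `^ (- s^-1))%:E *
                 normp_on s Q (T (fun y => (f y * \1_(~` cube (dil3 Q)) y)%R)))%E
            | Q in [set Q | is_cube Q /\ cube Q x]].

Definition bdd_cpt (f : Rd -> R) : Prop :=
  [/\ measurable_fun setT f, (exists M : R, forall x, `|f x| <= M)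
    & exists Q, is_cube Q /\ forall x, f x != 0 -> cube Q x].

End Rd.

(* Main.v *)
(* The proof is a double Calderon-Zygmund iteration on dyadic cells. For a cell Q write
   f_Q = f 1_{9Q} and G_Q = T1 T2 f_Q. The weak type hypotheses give a set O_Q of measure
   at most 2^-(d+2)|Q| outside of which |G_Q| is at most a multiple of A0 ||f||_{9Q} and
   the two maximal operators are controlled. If P are the stopping cells of O_Q, then on P
     G_Q = T1(1_{(3P)^c} T2 f_Q) - T1(1_{(3P)^c} T2 f_P) + T1(1_{3P} T2(f_Q 1_{(9P)^c})) + G_P,
   where the first two terms have r'-averages over P controlled by the maximal operator of
   T1, and the third one by the boundedness of T1 on L^{r'} and the maximal operator of T2.
   Telescoping along the chain of stopping cells around a point, which is finite almost
   everywhere, gives H1 (from the first two terms and the last G_Q) and H2 (from the third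
   term); each cell contributes one term of the sparse form by Hoelder's inequality.

   O_Q is taken to be a union of dyadic cells, so that outer regularity replaces the
   Lebesgue differentiation theorem: every point of O_Q then lies in a stopping cell. *)
Require Import Defs.
From HB Require Import structures.
From mathcomp Require Import all_boot all_order all_algebra.
From mathcomp Require Import all_classical all_reals all_analysis.
From mathcomp Require Import measurable_realfun zify ring lra.
Set Implicit Arguments. Unset Strict Implicit. Unset Printing Implicit Defensive.
Import Order.TTheory GRing.Theory Num.Theory.
Local Open Scope classical_set_scope.
Local Open Scope ring_scope.

(** * Lebesgue measure on tuples *)

(** Three budgets fix the constants. O_Q collects three exceptional sets and one outer regularity
    error, each of measure at most 2^-(d+4)|Q|; raising the levels by the factor [kbig] achieves
    this. A stopping cell is filled by O_Q to more than 2^-(d+1), so the stopping cells cover at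
    most half of Q, and the half they miss witnesses the sparsity of 9Q. The dyadic parent of a
    stopping cell P is filled to at most 2^-(d+1), so P is not contained in O_Q; hence P is not one
    of the bad cells of which O_Q is made, and the averages over P are controlled.

    Measurability is an obstacle: the maximal operators are suprema over uncountably many cubes, and
    their superlevel sets are not known to be measurable. They enter only as sets containing unions
    of cells, through monotonicity of [leb] on arbitrary sets.

    Since H1 + H2 has to equal T1 T2 f on all of R^d, the iteration starts from a partition of R^d
    into top cells of growing size, each with the support of f inside its ninefold dilate. *)

Definition cons_pair {R : realType} {n : nat} (p : R * n.-tuple R) : n.+1.-tuple R :=
  [tuple of p.1 :: p.2].

Lemma measurable_cons_pair (R : realType) n :
  measurable_fun setT (@cons_pair R n).
Proof. exact: (measurable_cons measurable_fst measurable_snd). Qed.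

Definition uncons_tuple {R : realType} {n : nat} (t : n.+1.-tuple R) : R * n.-tuple R :=
  (thead t, [tuple of behead t]).

Lemma measurable_uncons_tuple (R : realType) n :
  measurable_fun setT (@uncons_tuple R n).
Proof.
apply/measurable_fun_pairP; split; last exact: measurable_behead.
exact: (measurable_tnth ord0).
Qed.

Lemma cons_pairK (R : realType) n : cancel (@cons_pair R n) uncons_tuple.
Proof. by case=> x t; congr pair; apply/val_inj. Qed.

(** The measure [m] is a parameter because, inside the induction that makes [leb] a measure, [leb]
    at [n] is only known to coincide with some bundled measure. *)
Lemma lebS (R : realType) n (m : {sigma_finite_measure set (n.-tuple R) -> \bar R}) :
  (m : set _ -> \bar R) = @leb R n ->
  @leb R n.+1 = pushforward (@lebesgue_measure R \x m)%E cons_pair.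
Proof.
move=> mE; apply/funext => A /=; rewrite /pushforward /product_measure1 -mE.
apply: eq_integral => x _ /=; congr (m _).
by apply/seteqP; split => t; rewrite /xsection /= inE.
Qed.

(** Sigma-finiteness has to be part of the induction, since the product with the one-dimensional
    measure needs a sigma-finite second factor. *)
Lemma leb_sigma_finite_measure (R : realType) n :
  exists m : {sigma_finite_measure set (n.-tuple R) -> \bar R},
    (m : set _ -> \bar R) = @leb R n.
Proof.
elim: n => [|n [m mE]].
  exists (dirac ([tuple] : 0.-tuple R)).
  by apply/funext => A /=; rewrite diracE.
pose mp := @measurable_cons_pair R n.
pose p0 : {measure set _ -> \bar R} := pushforward (@lebesgue_measure R \x m)%E cons_pair.
pose p := p0 mp.
have pf : sigma_finite setT p.
  have /sigma_finiteP[F [FT ndF Foo]] := sigma_finiteT (@lebesgue_measure R).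
  have /sigma_finiteP[G [GT ndG Goo]] := sigma_finiteT m.
  exists (fun k => uncons_tuple @^-1` (F k `*` G k)).
    rewrite -preimage_bigcup (_ : \bigcup_k _ = setT) ?preimage_setT//.
    apply/seteqP; split => // -[x t] _.
    have [i _ Fi] : (\bigcup_k F k) x by rewrite -FT.
    have [j _ Gj] : (\bigcup_k G k) t by rewrite -GT.
    exists (maxn i j) => //; split => /=.
      by move: x Fi; exact/subsetPset/ndF/leq_maxl.
    by move: t Gj; exact/subsetPset/ndG/leq_maxr.
  move=> k; have [mF lF] := Foo k; have [mG lG] := Goo k; split.
    rewrite -[X in measurable X]setTI; apply: measurable_uncons_tuple => //.
    exact: measurableX.
  rewrite /p /p0 /= /pushforward -comp_preimage (_ : _ \o _ = id); last first.
    by apply/funext => y; exact: cons_pairK.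
  by rewrite preimage_id product_measure1E// lte_mul_pinfty// ge0_fin_numE.
pose H := Measure_isSigmaFinite.Build _ _ _ p pf.
pose q := HB.pack_for (SigmaFiniteMeasure.type (n.+1.-tuple R) R) (Measure.sort p) H.
by exists q; rewrite (lebS mE).
Qed.

Section leb_measure.
Context (R : realType) (d : nat).

Let leb0 : @leb R d set0 = 0%E.
Proof. by have [m <-] := leb_sigma_finite_measure R d; rewrite measure0. Qed.

Let leb_ge0 A : (0 <= @leb R d A)%E.
Proof. by have [m <-] := leb_sigma_finite_measure R d. Qed.

Let leb_additive : semi_sigma_additive (@leb R d).
Proof.
by have [m <-] := leb_sigma_finite_measure R d; exact: measure_semi_sigma_additive.
Qed.

HB.instance Definition _ := isMeasure.Build _ _ _ (@leb R d) leb0 leb_ge0 leb_additive.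

Let leb_sigma_finite : sigma_finite setT (@leb R d).
Proof. by have [m <-] := leb_sigma_finite_measure R d; exact: sigma_finiteT. Qed.

HB.instance Definition _ := Measure_isSigmaFinite.Build _ _ _ (@leb R d) leb_sigma_finite.

End leb_measure.

(** The integral of a nonnegative function is a supremum over simple functions below it, which is
    monotone whether or not the functions are measurable. *)
Lemma le_integral_nonmeasurable d (T : measurableType d) (R : realType)
    (mu : set T -> \bar R) (f g : T -> \bar R) :
  (forall x, 0 <= f x)%E -> (forall x, f x <= g x)%E ->
  (\int[mu]_x f x <= \int[mu]_x g x)%E.
Proof.
move=> f0 fg; have g0 x : (0 <= g x)%E by exact: le_trans (fg x).
rewrite /integral !patch_setT.
have e0 (h : T -> \bar R) : (forall x, 0 <= h x)%E -> h ^\+%E = h /\ h ^\-%E = cst 0%E.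
  move=> h0; split; apply/funext => x; first by rewrite funeposE; apply/max_idPl.
  by rewrite funenegE; apply/max_idPr; rewrite leeNl oppe0.
have [-> ->] := e0 _ f0; have [-> ->] := e0 _ g0.
apply: leeB => //; apply: le_ereal_sup => _ [h hf <-]; exists h => // x.
exact: le_trans (hf x) (fg x).
Qed.

(** Stated for arbitrary sets, so that it applies to superlevel sets of [Mop]. *)
Lemma leb_le (R : realType) n (A B : set (n.-tuple R)) :
  A `<=` B -> (leb A <= leb B)%E.
Proof.
elim: n A B => [|n IH] A B AB /=.
  rewrite lee_fin !indicE ler_nat.
  have [/set_mem/AB/mem_set -> //|//] := boolP ([tuple] \in A).
apply: le_integral_nonmeasurable => x; first exact: measure_ge0.
by apply: IH => t /=; exact: AB.
Qed.

Definition box (R : realType) n (B : 'I_n -> set R) : set (n.-tuple R) :=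
  [set x | forall i, B i (tnth x i)].

Lemma measurable_box (R : realType) n (B : 'I_n -> set R) :
  (forall i, measurable (B i)) -> measurable (box B).
Proof.
move=> mB; rewrite (_ : box B = \bigcap_(i in [set: 'I_n]) ((@tnth n R)^~ i @^-1` B i)).
  apply: fin_bigcap_measurable => // i _.
  by rewrite -[X in measurable X]setTI; exact: measurable_tnth.
by apply/seteqP; split => x /= Bx i; [move=> _|]; exact: Bx.
Qed.

Lemma leb_box (R : realType) n (B : 'I_n -> set R) :
  (forall i, measurable (B i)) ->
  leb (box B) = (\prod_(i < n) lebesgue_measure (B i))%E.
Proof.
elim: n B => [|n IH] B mB /=.
  by rewrite big_ord0 indicE mem_set// => -[].
rewrite big_ord_recl -(IH (fun i => B (lift ord0 i)))//.
transitivity (\int[@lebesgue_measure R]_x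
    ((\1_(B ord0) x)%:E * leb (box (fun i => B (lift ord0 i)))))%E; last first.
  rewrite ge0_integralZr//.
    by rewrite integral_indic ?setIT//; exact: mB.
  apply/measurable_EFinP; apply: measurable_indic; exact: mB.
apply: eq_integral.
move=> x _; rewrite indicE; have [xB|xB] := boolP (x \in B ord0).
  rewrite mul1e; congr leb; apply/seteqP; split => t /= tB i.
    by have := tB (lift ord0 i); rewrite tnthS.
  case: (unliftP ord0 i) => [j ->|->]; first by rewrite tnthS.
  by rewrite tnth0; exact: set_mem.
rewrite mul0e (_ : [set t | _] = set0) ?measure0//.
apply/seteqP; split => t //= /(_ ord0); rewrite tnth0 => ?.
by move/negP: xB; apply; exact: mem_set.
Qed.

(** * Dyadic cells *)

Section dyadic.
Context {R : realType} {d : nat}.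
Local Notation Rd := (d.-tuple R).
Local Notation cellT := (int * d.-tuple int)%type.
Implicit Types (x y : Rd) (P Q : cellT).

Definition side (k : int) : R := 2 ^ (- k).

Lemma side_gt0 k : 0 < side k. Proof. by rewrite exprz_gt0. Qed.

Lemma sideS k : side k = 2 * side (k + 1).
Proof. by rewrite /side opprD exprzDr ?unitfE// mulrCA mulfV ?mulr1// expr1z. Qed.

Definition idx (k : int) (x : Rd) : d.-tuple int :=
  [tuple Num.floor (2 ^ k * tnth x i) | i < d].

(** Cells are half-open, hence each point lies in exactly one cell of each level, and they are
    indexed by a countable type, on which all countable unions and gluings below rest. Higher levels
    are smaller cells. *)
Definition cell P : set Rd := [set x | idx P.1 x = P.2].

Definition cell_at k x : cellT := (k, idx k x).

Lemma mem_cell_at k x : cell (cell_at k x) x. Proof. by []. Qed.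

Lemma cell_atE P x : cell P x -> P = cell_at P.1 x.
Proof. by case: P => k m; rewrite /cell/= => <-. Qed.

Lemma cellP P x : cell P x <->
  forall i, side P.1 * (tnth P.2 i)%:~R <= tnth x i < side P.1 * (tnth P.2 i + 1)%:~R.
Proof.
have p0 : 0 < 2 ^ P.1 :> R by rewrite exprz_gt0.
have e i z : (side P.1 * z <= tnth x i) = (z <= 2 ^ P.1 * tnth x i).
  by rewrite /side -invr_expz mulrC ler_pdivrMr// mulrC.
have e' i z : (tnth x i < side P.1 * z) = (2 ^ P.1 * tnth x i < z).
  by rewrite /side -invr_expz mulrC ltr_pdivlMr// mulrC.
split=> [<- i|h].
  by rewrite e e' tnth_mktuple floor_le_tmp floorD1_gt.
apply: eq_from_tnth => i; rewrite tnth_mktuple; apply/floor_def.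
by rewrite -e -e'.
Qed.

(** The floor of [2 * z] is twice the floor of [z], or one more, so it determines the floor of [z];
    this is iterated over [n] levels. *)
Lemma idx_coarsen (k : int) (n : nat) x y : idx (k + n) x = idx (k + n) y -> idx k x = idx k y.
Proof.
elim: n => [|n IH]; first by rewrite addr0.
have -> : k + n.+1 = k + n + 1 by lia.
move=> h; apply: IH; move: h; move: (k + n) => {}k h.
apply: eq_from_tnth => i; have := congr1 (fun t => tnth t i) h.
have p2 (z : R) : 2 ^ (k + 1) * z = 2 * (2 ^ k * z).
  by rewrite exprzDr ?unitfE// expr1z mulrAC mulrC.
rewrite !tnth_mktuple !p2.
set a := _ * tnth x i; set b := _ * tnth y i => e.
have l (z : R) : 2 * Num.floor z <= Num.floor (2 * z) /\ Num.floor (2 * z) < 2 * Num.floor z + 2.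
  split; first by rewrite floor_ge_int_tmp rmorphM/= ler_pM2l// floor_le_tmp.
  rewrite floor_lt_int rmorphD rmorphM/= -[X in _ + X]mulr1 -mulrDr ltr_pM2l//.
  by have := floorD1_gt z; rewrite rmorphD.
have := l a; have := l b; rewrite e.
move: (Num.floor a) (Num.floor b) (Num.floor (2 * b)) => u v w; lia.
Qed.

Lemma cell_nested P Q x : cell P x -> cell Q x -> Q.1 <= P.1 -> cell P `<=` cell Q.
Proof.
move=> Px Qx; rewrite -subr_ge0; case E : (P.1 - Q.1) => [n|//] _ y Py.
have PE : P.1 = Q.1 + n by rewrite -E addrC subrK.
rewrite /cell /= -Qx; apply: (@idx_coarsen _ n); rewrite -PE; exact: etrans Py (esym Px).
Qed.

Definition corner P : Rd := [tuple side P.1 * (tnth P.2 i)%:~R | i < d].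

Lemma cell_corner P : cell P (corner P).
Proof.
apply/cellP => i; rewrite tnth_mktuple lexx/= ltr_pM2l ?side_gt0// ltr_int; lia.
Qed.

Definition closed_cell P : Rd * R :=
  ([tuple side P.1 * ((tnth P.2 i)%:~R + 2^-1) | i < d], side P.1).

Lemma cell_sub_cube P : cell P `<=` cube (closed_cell P).
Proof.
move=> x /cellP Px i; have := Px i; rewrite tnth_mktuple rmorphD/= mulrDr mulr1 => h.
by rewrite ler_norml; lra.
Qed.

Lemma cell_cover_side P Q : cell P `<=` cell Q -> forall i,
  side Q.1 * (tnth Q.2 i)%:~R <= side P.1 * (tnth P.2 i)%:~R /\
  side P.1 * (tnth P.2 i)%:~R + side P.1 <= side Q.1 * (tnth Q.2 i)%:~R + side Q.1.
Proof.
move=> PQ i.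
have hc : side Q.1 * (tnth Q.2 i)%:~R <= side P.1 * (tnth P.2 i)%:~R
          < side Q.1 * (tnth Q.2 i)%:~R + side Q.1.
  have /PQ/cellP/(_ i) := cell_corner P.
  by rewrite tnth_mktuple (rmorphD _ (tnth Q.2 i))/= mulrDr mulr1.
split; first by case/andP: hc.
rewrite leNgt; apply/negP => h.
(* If [P] stuck out of [Q] in direction [i], moving diagonally from the corner of [P] up to the
   upper face of [Q] would give a point of [P] outside the half-open cell [Q]. *)
pose y : Rd := [tuple side P.1 * (tnth P.2 j)%:~R +
  (side Q.1 * (tnth Q.2 i)%:~R + side Q.1 - side P.1 * (tnth P.2 i)%:~R) | j < d].
have /PQ/cellP/(_ i) : cell P y.
  apply/cellP => j; rewrite tnth_mktuple rmorphD/= mulrDr mulr1; lra.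
rewrite tnth_mktuple (rmorphD _ (tnth Q.2 i))/= mulrDr mulr1; lra.
Qed.

(** Before dilation the faces of [P] lie between those of [Q]; the dilation moves faces outwards by
    (c-1)/2 times the side, which is at least as much for the larger cell. *)
Lemma cube_dilate_sub P Q (c : R) : 1 <= c -> cell P `<=` cell Q ->
  cube ((closed_cell P).1, c * (closed_cell P).2) `<=`
  cube ((closed_cell Q).1, c * (closed_cell Q).2).
Proof.
move=> c1 PQ x Px i; have := Px i; have [] := cell_cover_side PQ i.
rewrite !tnth_mktuple /= !mulrDr.
move: (side P.1) (side Q.1) => p q.
move: (p * _) (q * (tnth _ _)%:~R) => a b h1 h2.
have pq : p <= q by lra.
have : 0 <= (c - 1) * (q - p) by rewrite mulr_ge0; lra.
rewrite !ler_norml; lra.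
Qed.

Lemma measurable_cell P : measurable (cell P).
Proof.
rewrite (_ : cell P = box (fun i => `[side P.1 * (tnth P.2 i)%:~R,
    side P.1 * (tnth P.2 i + 1)%:~R[%classic)); last first.
  by apply/seteqP; split => x /= => [/cellP h i|h]; [|apply/cellP => i];
    have := h i; rewrite /= in_itv.
by apply: measurable_box => i; exact: measurable_itv.
Qed.

Lemma leb_cell P : leb (cell P) = (side P.1 ^+ d)%:E.
Proof.
rewrite (_ : cell P = box (fun i => `[side P.1 * (tnth P.2 i)%:~R,
    side P.1 * (tnth P.2 i + 1)%:~R[%classic)); last first.
  by apply/seteqP; split => x /= => [/cellP h i|h]; [|apply/cellP => i];
    have := h i; rewrite /= in_itv.
rewrite leb_box => [|i]; last exact: measurable_itv.
rewrite (eq_bigr (fun=> (side P.1)%:E)) => [|i _]; last first.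
  rewrite lebesgue_measure_itv/= lte_fin ltr_pM2l ?side_gt0// ltr_int ltrDl ltr01.
  by rewrite -EFinB -mulrBr -rmorphB/= addrAC subrr add0r mulr1.
by rewrite prodEFin prodr_const card_ord.
Qed.

Lemma measurable_cube (Q : Rd * R) : measurable (cube Q).
Proof.
rewrite (_ : cube Q = box (fun i => `[tnth Q.1 i - Q.2 / 2,
    tnth Q.1 i + Q.2 / 2]%classic)); last first.
  by apply/seteqP; split => x h i; have := h i; rewrite /= in_itv/= ler_distl.
by apply: measurable_box => i; exact: measurable_itv.
Qed.

Lemma leb_cube (Q : Rd * R) : is_cube Q -> leb (cube Q) = (vol Q)%:E.
Proof.
rewrite /is_cube => Q0.
rewrite (_ : cube Q = box (fun i => `[tnth Q.1 i - Q.2 / 2,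
    tnth Q.1 i + Q.2 / 2]%classic)); last first.
  by apply/seteqP; split => x h i; have := h i; rewrite /= in_itv/= ler_distl.
rewrite leb_box => [|i]; last exact: measurable_itv.
rewrite (eq_bigr (fun=> (Q.2)%:E)) => [|i _]; last first.
  rewrite lebesgue_measure_itv/= lte_fin ifT; last by lra.
  by rewrite -EFinB; congr EFin; lra.
by rewrite prodEFin prodr_const card_ord.
Qed.

End dyadic.

(** * Dyadic open sets and outer regularity *)

Section dyadic_open.
Context {R : realType} {d : nat}.
Local Notation Rd := (d.-tuple R).
Local Notation cellT := (int * d.-tuple int)%type.
Local Notation cell := (@cell R d).
Implicit Types (x y : Rd) (P Q : cellT) (O A F : set Rd).

Lemma bigcup_countType_measurable (dT : measure_display) (T : measurableType dT)
    (I : countType) (D : set I) (F : I -> set T) :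
  (forall i, measurable (F i)) -> measurable (\bigcup_(i in D) F i).
Proof.
move=> mF; rewrite bigcup_mkcond; apply: countable_bigcupT_measurable => // i.
by case: ifP.
Qed.

(** The open sets of the topology generated by the dyadic cells. Cells are open and closed in it,
    and the half-spaces that generate the Borel sets are open. *)
Definition dopen O := forall x, O x -> exists k, cell (cell_at k x) `<=` O.

Lemma dopen_bigcup (I : Type) (D : set I) (O : I -> set Rd) :
  (forall i, D i -> dopen (O i)) -> dopen (\bigcup_(i in D) O i).
Proof.
move=> h x [i Di Ox]; have [k kO] := h i Di x Ox.
by exists k => y /kO; exists i.
Qed.

Lemma dopen_cell P : dopen (cell P).
Proof. by move=> x Px; exists P.1; rewrite -cell_atE. Qed.

Lemma cell_at_sub (k l : int) x : k <= l -> cell (cell_at l x) `<=` cell (cell_at k x).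
Proof. by move=> kl; exact: (cell_nested (mem_cell_at l x) (mem_cell_at k x) kl). Qed.

Lemma dopenI O1 O2 : dopen O1 -> dopen O2 -> dopen (O1 `&` O2).
Proof.
move=> h1 h2 x [/h1[k1 kO1] /h2[k2 kO2]]; exists (Order.max k1 k2) => y ky.
by split; [apply: kO1|apply: kO2]; apply: cell_at_sub ky; rewrite le_max lexx ?orbT.
Qed.

Lemma dopenE O : dopen O -> O = \bigcup_(P in [set P | cell P `<=` O]) cell P.
Proof.
move=> dO; apply/seteqP; split => [x /dO[k kO]|x [P PO /PO]//].
by exists (cell_at k x).
Qed.

Lemma dopen_measurable O : dopen O -> measurable O.
Proof.
move=> /dopenE ->; apply: bigcup_countType_measurable => P; exact: measurable_cell.
Qed.

Lemma exists_small_side (e : R) : 0 < e -> exists k, side k < e.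
Proof.
move=> e0; exists (Num.bound e^-1)%:Z.
rewrite /side -invr_expz invf_plt ?posrE ?exprz_gt0//.
by rewrite -exprnP; exact: upper_nthrootP.
Qed.

Lemma cell_at_dist k x y i : cell (cell_at k x) y -> `|tnth y i - tnth x i| < side k.
Proof.
move=> /cellP/(_ i) h1; have /cellP/(_ i) := mem_cell_at k x.
move: h1 => /=; rewrite rmorphD/= mulrDr mulr1 ltr_norml; lra.
Qed.

Lemma dopen_setC_cell P : dopen (~` cell P).
Proof.
move=> x nPx; exists P.1 => y xy Py; apply: nPx.
by move: Py xy; rewrite /cell /= => <- <-.
Qed.

Lemma dopen_halfspace (i : 'I_d) (a : R) : dopen [set x | a < tnth x i].
Proof.
move=> x /=; rewrite -subr_gt0 => /exists_small_side[k hk].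
exists k => y /(@cell_at_dist _ _ _ i); rewrite /= ltr_norml; lra.
Qed.

Lemma dopen_bigcap_ord (O : nat -> set Rd) n : (forall i, dopen (O i)) ->
  dopen (\bigcap_(i in `I_n) O i).
Proof.
move=> dO; elim: n => [|n IH]; last first.
  rewrite IIS bigcap_setU bigcap_set1; exact: dopenI.
by rewrite II0 bigcap_set0 => x _; exists 0.
Qed.

(** Approximating from inside as well as outside makes the property stable under complements.
    Measuring the gap inside a fixed cell keeps it finite, as continuity from above requires. *)
Definition dyadic_regular Q A := measurable A /\ forall e : R, 0 < e ->
  exists O F, [/\ dopen O, dopen (~` F), F `<=` A, A `<=` O
                & (leb (cell Q `&` (O `\` F)) <= e%:E)%E].

Lemma dyadic_regular_cell Q P : dyadic_regular Q (cell P).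
Proof.
split=> [|e e0]; first exact: measurable_cell.
exists (cell P), (cell P); split => //; [exact: dopen_cell|exact: dopen_setC_cell|].
by rewrite setDv setI0 measure0 lee_fin ltW.
Qed.

Lemma dyadic_regularC Q A : dyadic_regular Q A -> dyadic_regular Q (~` A).
Proof.
move=> [mA h]; split=> [|e /h [ O [F [dO dF FA AO OF]]]]; first exact: measurableC.
exists (~` F), (~` O); split => //; rewrite ?setCK//; try exact: subsetC.
by rewrite setDE setCK setIC (setIC _ O) -setDE setIC.
Qed.

(** The outer set is the union of the outer sets, with errors summing to [e / 2]. An infinite union
    of closed sets need not be closed, so only finitely many inner sets are kept: the gaps [D N]
    decrease to a set of measure at most [e / 2], and some [D N] has measure at most [e]. *)
Lemma dyadic_regular_bigcup Q (A : nat -> set Rd) :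
  (forall n, dyadic_regular Q (A n)) -> dyadic_regular Q (\bigcup_n A n).
Proof.
move=> h; split=> [|e e0]; first by apply: bigcupT_measurable => n; have [] := h n.
have e20 : 0 < e / 2 by rewrite divr_gt0.
have /choice[OF hOF] : forall n, exists OF : set Rd * set Rd,
    [/\ dopen OF.1, dopen (~` OF.2), OF.2 `<=` A n, A n `<=` OF.1
      & (leb (cell Q `&` (OF.1 `\` OF.2)) <= (e / 2 / (2 ^ n.+1)%:R)%:E)%E].
  move=> n; have [_ /(_ (e / 2 / (2 ^ n.+1)%:R)) hn] := h n; case: hn => [|O [F ?]].
    by rewrite divr_gt0// ltr0n expn_gt0.
  by exists (O, F).
pose O := \bigcup_n (OF n).1; pose F N := \bigcup_(n in `I_N) (OF n).2.
have dO : dopen O by apply: dopen_bigcup => n _; have [] := hOF n.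
have dF N : dopen (~` F N).
  by rewrite /F setC_bigcup; apply: dopen_bigcap_ord => n; have [] := hOF n.
have mF n : measurable (OF n).2.
  by have [_ /dopen_measurable/measurableC + _ _ _] := hOF n; rewrite setCK.
pose D N := cell Q `&` (O `\` F N).
have mD N : measurable (D N).
  apply: measurableI; first exact: measurable_cell.
  apply: measurableD; first exact: dopen_measurable.
  by apply: bigcup_measurable => *; exact: mF.
have mDoo : (leb (\bigcap_N D N) <= (e / 2)%:E)%E.
  apply: (@le_trans _ _ (\sum_(0 <= n <oo) leb (cell Q `&` ((OF n).1 `\` (OF n).2)))%E).
    have mG n : measurable (cell Q `&` ((OF n).1 `\` (OF n).2)).
      apply: measurableI; first exact: measurable_cell.
      by apply: measurableD => //; have [/dopen_measurable + _ _ _ _] := hOF n; exact.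
    apply: measure_sigma_subadditive => //.
      exact: bigcapT_measurable.
    move=> x xD; have [Qx [[n _ On] _]] := xD 0%N I.
    exists n => //; split => //; split => // Fn.
    by have [_ [_ nF]] := xD n.+1 I; apply: nF; exists n => /=.
  apply: le_trans (epsilon_trick0 xpredT (ltW e20)).
    apply: lee_nneseries => n *; first exact: measure_ge0.
    by have [] := hOF n.
apply: contrapT => nex.
suff : (e%:E <= (e / 2)%:E)%E by rewrite lee_fin; lra.
apply: le_trans mDoo.
have ndD : {homo D : n m / (n <= m)%N >-> (m <= n)%O}.
  move=> n m nm; apply/subsetPset => x [Qx [Ox nF]]; split => //; split => // -[k /= kn Fk].
  by apply: nF; exists k => //=; exact: leq_trans kn nm.
have D0 : (leb (D 0%N) < +oo)%E.
  apply: (@le_lt_trans _ _ (leb (cell Q))); first by apply: leb_le => x [].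
  by rewrite leb_cell ltry.
have cv := nonincreasing_cvg_mu D0 mD (bigcapT_measurable mD) ndD.
rewrite -(cvg_lim _ cv)//; apply: lime_ge; first by apply/cvg_ex; eexists; exact: cv.
apply: nearW => N /=; rewrite leNgt; apply/negP => /ltW DN; apply: nex.
exists O, (F N); split => //.
  by move=> x [n _ Fn]; exists n => //; have [_ _ + _ _] := hOF n; exact.
by move=> x [n _ An]; exists n => //; have [_ _ _ + _] := hOF n; exact.
Qed.

Lemma dyadic_regular_dopen Q O : dopen O -> dyadic_regular Q O.
Proof.
move=> /dopenE ->.
rewrite (_ : \bigcup_(P in _) cell P = \bigcup_n
    (if unpickle n is Some P then if `[< cell P `<=` O >] then cell P else set0 else set0)).
  apply: dyadic_regular_bigcup => n.
  have r0 : dyadic_regular Q set0.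
    split=> [//|e e0]; exists set0, set0; split => //; first by rewrite setC0 => x _; exists 0.
    by rewrite setDv setI0 measure0 lee_fin ltW.
  case: unpickle => [P|//]; case: asboolP => // _; exact: dyadic_regular_cell.
apply/seteqP; split => x.
  move=> [P PO Px]; apply: (ex_intro2 _ _ (pickle P) I).
  by rewrite pickleK; case: asboolP.
by move=> [n _]; case: unpickle => [P|//]; case: asboolP => // PO Px; exists P.
Qed.

(** The regular sets form a sigma-algebra. The principle [sa] is applied twice, to reduce to
    preimages under coordinates and then to preimages of open rays, which are half-spaces. *)
Lemma measurable_dyadic_regular Q A : measurable A -> dyadic_regular Q A.
Proof.
have sa (I : Type) (f : Rd -> I) (S : set (set I)) :
    (forall B, S B -> dyadic_regular Q (f @^-1` B)) ->
    (<<s S >>) `<=` [set B | dyadic_regular Q (f @^-1` B)].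
  move=> SB; apply: smallest_sub => //; split.
  - rewrite /= preimage_set0; split=> // e e0; exists set0, set0; split => //.
      by rewrite setC0 => x _; exists 0.
    by rewrite setDv setI0 measure0 lee_fin ltW.
  - by move=> B /= rB; rewrite setTD preimage_setC; exact: dyadic_regularC.
  - by move=> F /= rF; rewrite preimage_bigcup; exact: dyadic_regular_bigcup.
move=> mA; apply: (sa _ id _ _ _ mA) => B.
rewrite -bigcup_seq /= => -[i _ [C mC <-]]; rewrite preimage_id setTI.
have {}mC : (<<s @RGenOInfty.G R >>) C.
  have e := congr1 (fun M => M C) (RGenOInfty.measurableE R).
  exact: (eq_ind _ (fun X => X) mC _ e).
apply: (sa _ _ (@RGenOInfty.G R)) mC => _ [a ->].
apply: dyadic_regular_dopen; rewrite (_ : _ @^-1` _ = [set x | a < tnth x i]).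
  exact: dopen_halfspace.
by apply/seteqP; split => x /=; rewrite in_itv/= andbT.
Qed.

Lemma dyadic_outer_regular Q A (e : R) : measurable A -> A `<=` cell Q -> 0 < e ->
  exists O, [/\ dopen O, A `<=` O, O `<=` cell Q & (leb O <= leb A + e%:E)%E].
Proof.
move=> mA AQ e0; have [_ /(_ e e0) [ O [F [dO dF FA AO OF]]]] := measurable_dyadic_regular Q mA.
exists (O `&` cell Q); split => //.
- by apply: dopenI => //; exact: dopen_cell.
- by move=> x Ax; split; [exact: AO|exact: AQ].
- have mF : measurable F by have := measurableC (dopen_measurable dF); rewrite setCK.
  have mO := dopen_measurable dO; have mQ := @measurable_cell R d Q.
  apply: (@le_trans _ _ (leb (F `|` (cell Q `&` (O `\` F))))).
    apply: leb_le => x [Ox Qx]; have [Fx|nFx] := pselect (F x); [by left|by right].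
  have mD : measurable (cell Q `&` (O `\` F)) by apply: measurableI => //; exact: measurableD.
  apply: le_trans (measureU2 _ mF mD) _; apply: leeD => //; exact: leb_le.
Qed.

End dyadic_open.

(** * Gluing along countable partitions *)

Section countable_fibers.
Context {dX : measure_display} {X : measurableType dX} {R : realType}.
Context {T : countType} (c : X -> T).
Hypothesis mc : forall t, measurable (c @^-1` [set t]).

Lemma fiber_measurable (B : set T) : measurable (c @^-1` B).
Proof.
rewrite (_ : c @^-1` B = \bigcup_(t in B) c @^-1` [set t]).
  rewrite bigcup_mkcond; apply: countable_bigcupT_measurable => // t.
  by case: ifP.
apply/seteqP; split => [x Bx|x [t Bt /= e]]; first by exists (c x).
by rewrite /= e.
Qed.

Lemma measurable_fun_glue {dY : measure_display} {Y : measurableType dY}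
    (f : T -> X -> Y) : (forall t, measurable_fun setT (f t)) ->
  measurable_fun setT (fun x => f (c x) x).
Proof.
move=> mf _ B mB; rewrite setTI.
rewrite (_ : _ @^-1` B = \bigcup_t (c @^-1` [set t] `&` f t @^-1` B)).
  apply: countable_bigcupT_measurable => // t; apply: measurableI => //.
  by rewrite -[X in measurable X]setTI; exact: mf.
apply/seteqP; split => [x Bx|x [t _ [/= e]]]; first by exists (c x).
by rewrite /= e.
Qed.

Lemma ge0_integral_fibers (mu : {measure set X -> \bar R}) (D : set X) (h : X -> \bar R) :
  measurable D -> measurable_fun setT h -> (forall x, 0 <= h x)%E ->
  (\int[mu]_(x in D) h x =
   \sum_(i <oo) \int[mu]_(x in D `&` (pickle \o c) @^-1` [set i]) h x)%E.
Proof.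
move=> mD mh h0.
have mF i : measurable (D `&` (pickle \o c) @^-1` [set i]).
  apply: measurableI => //; rewrite comp_preimage; exact: fiber_measurable.
have DE : D = \bigcup_i (D `&` (pickle \o c) @^-1` [set i]).
  by apply/seteqP; split => [x Dx|x [i _ []]//]; exists (pickle (c x)).
rewrite [in LHS]DE ge0_integral_bigcup//.
  exact: measurable_funTS.
apply/trivIsetP => i j _ _ ij; apply/seteqP; split => // x [[_ /= ei] [_ /= ej]].
by move/eqP: ij; rewrite -ei -ej.
Qed.

(** This passes from an estimate on single stopping cells to an estimate on everything they cover,
    with [c] sending a point to its stopping cell. *)
Lemma le_integral_fibers (mu : {measure set X -> \bar R}) (D : set X) (h h' : X -> \bar R) :
  measurable D -> measurable_fun setT h -> (forall x, 0 <= h x)%E ->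
  measurable_fun setT h' -> (forall x, 0 <= h' x)%E ->
  (forall t, \int[mu]_(x in D `&` c @^-1` [set t]) h x <=
             \int[mu]_(x in D `&` c @^-1` [set t]) h' x)%E ->
  (\int[mu]_(x in D) h x <= \int[mu]_(x in D) h' x)%E.
Proof.
move=> mD mh h0 mh' h'0 hh; rewrite !ge0_integral_fibers//.
apply: lee_nneseries => i *; first exact: integral_ge0.
case E : (@pickle_inv T i) => [t|].
  have -> : (pickle \o c) @^-1` [set i] = c @^-1` [set t].
    have := @pickle_invK T i; rewrite E /= => pt.
    apply/seteqP; split => x /=; last by move=> ->.
    by rewrite -pt => /(pcan_inj pickleK).
  exact: hh.
(* An index that codes no element of [T] has an empty fibre. *)
rewrite (_ : _ @^-1` _ = set0) ?setI0 ?integral_set0//.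
by apply/seteqP; split => // x /= e; move: E; rewrite -e pickleK_inv.
Qed.

End countable_fibers.

Lemma ge0_integral_esum_fibers {dX : measure_display} {X : measurableType dX} {R : realType}
    {T : countType} (c : X -> option T) (mu : {measure set X -> \bar R}) (h : X -> \bar R) :
  (forall t, measurable (c @^-1` [set t])) ->
  measurable_fun setT h -> (forall x, 0 <= h x)%E -> (forall x, c x = None -> h x = 0%E) ->
  (\int[mu]_x h x =
   \esum_(t in [set t | exists x, c x = Some t]) \int[mu]_(x in c @^-1` [set Some t]) h x)%E.
Proof.
move=> mc mh h0 hN; rewrite (ge0_integral_fibers mc)// nneseries_esumT; last first.
  by move=> n; exact: integral_ge0.
pose F := [set t | exists x, c x = Some t].
pose P := [set pickle (Some t) | t in F].
have z i : ~ P i -> (\int[mu]_(x in setT `&` (pickle \o c) @^-1` [set i]) h x = 0)%E.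
  move=> Pi; apply: integral0_eq => x [_ /= xi].
  case E : (c x) => [t|]; last exact: hN.
  by exfalso; apply: Pi; exists t; [exists x|rewrite -E].
transitivity (\esum_(i in P) \int[mu]_(x in setT `&` (pickle \o c) @^-1` [set i]) h x)%E.
  rewrite [RHS]esum_mkcond; apply: eq_esum => i _; case: ifPn => // /negP iP.
  by apply: z => Pi; apply: iP; exact: mem_set.
rewrite (@reindex_esum _ _ _ F P (pickle \o Some)).
  apply: eq_esum => t _; rewrite setTI; congr (integral _ _ _).
  apply/seteqP; split => x /=; last by move=> ->.
  exact: (pcan_inj pickleK).
split.
- by move=> t Ft; exists t.
- by move=> s t _ _ /(pcan_inj pickleK)[].
- by move=> i [t Ft <-]; exists t.
Qed.

(** * Stopping cells *)

Section stopping.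
Context {R : realType} {d : nat}.
Local Notation Rd := (d.-tuple R).
Local Notation cellT := (int * d.-tuple int)%type.
Local Notation cell := (@cell R d).
Local Notation side := (@side R).
Implicit Types (x y : Rd) (P Q : cellT).
Variable O : cellT -> set Rd.

(** The threshold 2^-(d+1) serves two purposes: a child of a cell that is not heavy is at most half
    filled by [O Q], and disjoint heavy cells have total measure at most half of [Q] when [O Q] has
    measure at most 2^-(d+2)|Q|. *)
Definition heavy Q P : Prop :=
  ((side P.1 ^+ d / 2 ^+ d.+1)%:E < leb (cell P `&` O Q))%E.

Definition stops Q x (n : nat) : bool := `[< heavy Q (cell_at (Q.1 + n.+1%:Z) x) >].

(* Calderon-Zygmund selection: the largest strict dyadic subcell of [Q] around [x]
   of which [O Q] fills more than a proportion 2^-(d+1). *)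
Definition next_cell Q x : option cellT :=
  if pselect (exists n, stops Q x n) is left h
  then Some (cell_at (Q.1 + (ex_minn h).+1%:Z) x) else None.

Lemma next_Some Q x P : next_cell Q x = Some P <-> exists n,
  [/\ P = cell_at (Q.1 + n.+1%:Z) x, stops Q x n & forall j, (j < n)%N -> ~~ stops Q x j].
Proof.
rewrite /next_cell; case: pselect => [h|nh]; last first.
  by split=> // -[n [_ sn _]]; exfalso; apply: nh; exists n.
case: ex_minnP => m sm minm; split=> [[<-]|[n [-> sn minn]]].
  exists m; split => // j; rewrite ltnNge; apply: contra; exact: minm.
congr (Some (cell_at (Q.1 + _.+1%:Z) x)); apply/eqP; rewrite eqn_leq minm//=.
by rewrite leqNgt; apply/negP => /minn; rewrite sm.
Qed.

Lemma next_None Q x n : next_cell Q x = None -> ~ heavy Q (cell_at (Q.1 + n.+1%:Z) x).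
Proof.
rewrite /next_cell; case: pselect => // nh _ dn; apply: nh; exists n; exact/asboolP.
Qed.

Lemma next_mem Q x P : next_cell Q x = Some P -> cell P x.
Proof. by move=> /next_Some[n [-> _ _]]. Qed.

Lemma next_level Q x P : next_cell Q x = Some P -> Q.1 < P.1.
Proof. by move=> /next_Some[n [-> _ _]] /=; lia. Qed.

Lemma next_sub Q x P : cell Q x -> next_cell Q x = Some P -> cell P `<=` cell Q.
Proof.
move=> Qx h; apply: (cell_nested (next_mem h) Qx); exact: ltW (next_level h).
Qed.

Lemma next_heavy Q x P : next_cell Q x = Some P -> heavy Q P.
Proof. by move=> /next_Some[n [-> /asboolP]]. Qed.

(** Two points of a cell lie in the same coarser cells, so the selection runs through the same tests
    for both. *)
Lemma next_const Q x y P : next_cell Q x = Some P -> cell P y -> next_cell Q y = Some P.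
Proof.
move=> /next_Some[n [PE sn minn]] Py; apply/next_Some; exists n.
have e j : (j <= n)%N -> cell_at (Q.1 + j.+1%:Z) y = cell_at (Q.1 + j.+1%:Z) x.
  move=> jn; rewrite /cell_at; congr pair; apply: (@idx_coarsen _ _ _ (n - j)%N).
  by rewrite (_ : _ + (n - j)%N%:Z = Q.1 + n.+1%:Z); [move: Py; rewrite PE|lia].
split; first by rewrite e.
  by rewrite /stops e.
by move=> j jn; rewrite /stops e ?minn// ltnW.
Qed.

Lemma next_fiber Q x P : next_cell Q x = Some P -> next_cell Q @^-1` [set Some P] = cell P.
Proof.
move=> h; apply/seteqP; split => y; first exact: next_mem.
exact: (next_const h).
Qed.

Lemma measurable_next Q t : measurable (next_cell Q @^-1` [set t]).
Proof.
have mS P : measurable (next_cell Q @^-1` [set Some P]).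
  have [[x h]|nh] := pselect (exists x, next_cell Q x = Some P).
    by rewrite (next_fiber h); exact: measurable_cell.
  rewrite (_ : _ @^-1` _ = set0)//; apply/seteqP; split => // x h.
  by apply: nh; exists x.
case: t => [P|]; first exact: mS.
rewrite (_ : _ @^-1` _ = ~` \bigcup_P next_cell Q @^-1` [set Some P]).
  by apply: measurableC; exact: countable_bigcupT_measurable.
apply/seteqP; split => x /= => [h [P _ /=]|h]; first by rewrite h.
by case E : (next_cell Q x) => [P|//]; exfalso; apply: h; exists P.
Qed.

Hypothesis Oopen : forall Q, dopen (O Q).
Hypothesis Osmall : forall Q, (leb (O Q) <= (side Q.1 ^+ d / 2 ^+ d.+2)%:E)%E.

Let mO Q : measurable (O Q). Proof. exact: dopen_measurable. Qed.

Lemma side_pow_gt0 (k : int) : 0 < side k ^+ d. Proof. by rewrite exprn_gt0 ?side_gt0. Qed.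

Lemma Osmall_lt Q (n : nat) : (n < d.+2)%N -> (leb (O Q) < (side Q.1 ^+ d / 2 ^+ n)%:E)%E.
Proof.
move=> nd; apply: le_lt_trans (Osmall Q) _; rewrite lte_fin ltr_pM2l ?side_pow_gt0//.
by rewrite ltf_pV2 ?posrE ?exprn_gt0// ltr_eXn2l// ltr1n.
Qed.

Lemma not_sub_O Q : ~ cell Q `<=` O Q.
Proof.
move=> /leb_le; rewrite leb_cell leNgt => /negP; apply.
by have := @Osmall_lt Q 0 isT; rewrite expr0 divr1.
Qed.

(** The parent [P'] of [P] is filled to at most 2^-(d+1), whereas [P] alone has the proportion 2^-d
    of its parent. *)
Lemma next_not_sub Q x P : next_cell Q x = Some P -> ~ cell P `<=` O Q.
Proof.
move=> /next_Some[n [-> sn minn]] sub.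
set P' := cell_at (Q.1 + n%:Z) x.
have : (leb (cell P' `&` O Q) <= (side P'.1 ^+ d / 2 ^+ d.+1)%:E)%E.
  (* For [n = 0] the parent has the level of [Q] and was not tested by the selection; there the
     smallness of [O Q] gives the bound. Otherwise it is minimality of [n]. *)
  case: n @P' sn minn sub => [|n] P' sn minn sub.
    rewrite /P' /= addr0; apply: le_trans (ltW (@Osmall_lt Q d.+1 _)); last by lia.
    by apply: leb_le => y [].
  by rewrite leNgt; apply/negP => dn; have /negP := minn n (ltnSn n); apply; apply/asboolP.
rewrite leNgt => /negP; apply.
apply: (@lt_le_trans _ _ (leb (cell (cell_at (Q.1 + n.+1%:Z) x)))); last first.
  apply: leb_le => y Py; split; last exact: sub.
  by apply: cell_at_sub Py; lia.
rewrite leb_cell /= lte_fin (sideS (Q.1 + n%:Z)).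
rewrite (_ : Q.1 + n%:Z + 1 = Q.1 + n.+1%:Z); last by lia.
rewrite exprMn exprS; set s := side _ ^+ d; have s0 : 0 < s := side_pow_gt0 _.
have u0 : 2 ^+ d != 0 :> R by rewrite expf_neq0.
have -> : 2 ^+ d * s / (2 * 2 ^+ d) = s / 2 by field.
lra.
Qed.

(** All sufficiently small cells around a point of the dyadic open set [O Q] lie inside it, and a
    full cell is heavy. *)
Lemma next_None_notin Q x : cell Q x -> next_cell Q x = None -> ~ O Q x.
Proof.
move=> Qx nN Ox; have [k kO] := Oopen Ox.
have [n kn] : exists n : nat, k <= Q.1 + n.+1%:Z.
  by exists `|k - Q.1|%N; lia.
apply: (@next_None _ _ n nN); rewrite /heavy.
have sub : cell (cell_at (Q.1 + n.+1%:Z) x) `<=` O Q.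
  by apply: subset_trans kO; exact: cell_at_sub.
rewrite (_ : _ `&` O Q = cell (cell_at (Q.1 + n.+1%:Z) x)); last exact/setIidPl.
rewrite leb_cell /= lte_fin ltr_pdivrMr ?exprn_gt0// ltr_pMr ?side_pow_gt0//.
by rewrite exprn_egt1// ltr1n.
Qed.

(* Every stopping cell carries a fixed proportion of [O Q]. *)
Lemma leb_next_le Q : (leb (cell Q `&` [set x | next_cell Q x <> None]) <= (side Q.1 ^+ d / 2)%:E)%E.
Proof.
have mN : measurable [set x | next_cell Q x <> None].
  exact: (fiber_measurable (measurable_next Q) [set t | t <> None]).
have mQ := @measurable_cell R d Q.
set N := [set x | _] in mN *.
rewrite -[X in leb X]setIC -(integral_indic _ mQ mN).
(* The two integrands are compared on each stopping cell, where heaviness says that its measure is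
   at most 2^(d+1) times that of its part in [O Q]. *)
apply: (@le_trans _ _ (\int[@leb R d]_(x in cell Q) (2 ^+ d.+1 * \1_(O Q) x)%:E)%E).
  apply: (le_integral_fibers (measurable_next Q)) => //.
  - by apply/measurable_EFinP; exact: measurable_indic.
  - by apply/measurable_EFinP; apply: measurable_funM => //; exact: measurable_indic.
  move=> t; have mF := measurable_next Q t.
  have mQF := measurableI _ _ mQ mF.
  under [leRHS]eq_integral do rewrite EFinM.
  rewrite ge0_integralZl_EFin//; last first.
    by apply/measurable_EFinP; exact: measurable_indic.
  rewrite !integral_indic//.
  case: t mF mQF => [P|] mF mQF; last first.
    rewrite (_ : N `&` _ = set0) ?measure0 ?mule_ge0 ?lee_fin ?exprn_ge0//.
    by apply/seteqP; split => // x [Nx [_ e]]; exact: (Nx e).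
  have [[x [Qx h]]|nh] := pselect (exists x, cell Q x /\ next_cell Q x = Some P); last first.
    rewrite (_ : N `&` _ = set0) ?measure0 ?mule_ge0 ?lee_fin ?exprn_ge0//.
    by apply/seteqP; split => // x [_ [Qx h]]; apply: nh; exists x.
  have sub := next_sub Qx h.
  rewrite (next_fiber h) (_ : cell Q `&` cell P = cell P); last exact/setIidPr.
  apply: (@le_trans _ _ (leb (cell P))); first by apply: leb_le => y [].
  rewrite leb_cell; apply: (@le_trans _ _ ((2 ^+ d.+1)%:E * (side P.1 ^+ d / 2 ^+ d.+1)%:E)%E).
    by rewrite -EFinM mulrCA mulfV ?mulr1// expf_neq0.
  apply: lee_wpmul2l; first by rewrite lee_fin exprn_ge0.
  by apply: ltW; rewrite setIC; exact: (next_heavy h).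
under eq_integral do rewrite EFinM.
rewrite ge0_integralZl_EFin//; last first.
  by apply/measurable_EFinP; exact: measurable_indic.
rewrite integral_indic//.
apply: (@le_trans _ _ ((2 ^+ d.+1)%:E * (side Q.1 ^+ d / 2 ^+ d.+2)%:E)%E).
  apply: lee_wpmul2l; first by rewrite lee_fin exprn_ge0.
  by apply: le_trans (Osmall Q); apply: leb_le => y [].
rewrite -EFinM lee_fin [in X in X <= _](exprS _ d.+1) invfM.
have u0 : 2 ^+ d.+1 != 0 :> R by rewrite expf_neq0.
rewrite -invfM le_eqVlt; apply/orP; left; apply/eqP; by field.
Qed.

End stopping.

(** * Top cells and the chains of stopping cells below them *)

Section chain.
Context {R : realType} {d : nat}.
Local Notation Rd := (d.-tuple R).
Local Notation cellT := (int * d.-tuple int)%type.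
Local Notation cell := (@cell R d).
Local Notation side := (@side R).
Implicit Types (x y : Rd) (P Q : cellT).

Section top_cell.
Variable J : nat.

Lemma side_neg (n : nat) : side (- n%:Z) = 2 ^+ n.
Proof. by rewrite /side opprK. Qed.

(** A hyperplane at an integer multiple of the side does not cut through a cell. *)
Lemma cell_grid P x y i (z : int) : cell P x -> cell P y ->
  (side P.1 * z%:~R <= tnth x i) = (side P.1 * z%:~R <= tnth y i).
Proof.
have e w : cell P w -> (side P.1 * z%:~R <= tnth w i) = (z <= tnth P.2 i).
  move=> /cellP/(_ i)/andP[h1 h2]; apply/idP/idP => [h|h].
    by have := le_lt_trans h h2; rewrite ltr_pM2l ?side_gt0// ltr_int; lia.
  by apply: le_trans h1; rewrite ler_pM2l ?side_gt0// ler_int.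
by move=> /e -> /e ->.
Qed.

Definition in_window (n : nat) x : bool :=
  [forall i, - 2 ^+ (J + n) <= tnth x i < 2 ^+ (J + n)].

Lemma in_window_le m n x : (m <= n)%N -> in_window m x -> in_window n x.
Proof.
move=> mn /forallP h; apply/forallP => i; have := h i.
have : 2 ^+ (J + m) <= 2 ^+ (J + n) :> R by rewrite ler_weXn2l// ?ler1n// leq_add2l.
lra.
Qed.

Lemma exists_in_window x : exists n, in_window n.+1 x.
Proof.
exists (Num.bound (\sum_i `|tnth x i|)); apply/forallP => i.
have : `|tnth x i| < 2 ^+ (Num.bound (\sum_i `|tnth x i|)).
  apply: le_lt_trans (upper_nthrootP (leqnn _)).
  by rewrite (bigD1 i)//= lerDl sumr_ge0.
move: (Num.bound _) => m h.
have : 2 ^+ m <= 2 ^+ (J + m.+1) :> R by rewrite ler_weXn2l// ?ler1n//; lia.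
by move: h; rewrite ltr_norml; lra.
Qed.

(** The faces of these windows are at multiples of the side 2^(J+n), so cells of level -(J+n) do not
    cross them. *)
Lemma in_window_cell (n : nat) (j : nat) x y : (j <= 1)%N ->
  cell (cell_at (- (J + n)%N%:Z) x) y -> in_window (n + j) x = in_window (n + j) y.
Proof.
move=> j1 xy; have xx := mem_cell_at (- (J + n)%N%:Z) x.
apply: eq_forallb => i.
have e : 2 ^+ (J + (n + j)) = side (- (J + n)%N%:Z) * ((2 ^ j)%N%:Z)%:~R.
  by rewrite side_neg -pmulrn natrX -exprD addnA.
have e' : - 2 ^+ (J + (n + j)) = side (- (J + n)%N%:Z) * (- (2 ^ j)%N%:Z)%:~R.
  by rewrite e rmorphN mulrN.
by rewrite e' e !ltNge (cell_grid i _ xx xy) (cell_grid i (2 ^ j)%N%:Z xx xy).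
Qed.

(* The level grows with the distance to the origin, which makes the ninefold
   dilate of a top cell contain the window [-2^J, 2^J]^d. *)
Definition top_cell x : cellT := cell_at (- (J + ex_minn (exists_in_window x))%N%:Z) x.

Lemma mem_top x : cell (top_cell x) x. Proof. exact: mem_cell_at. Qed.

(** Top cells of different sizes form a partition. Minimality transfers between [x] and [y] in both
    directions: [y] lies in the window [n.+1] of [x], and if [y] were in a window of index at most
    [n], so would be [x]. *)
Lemma top_const x y : cell (top_cell x) y -> top_cell y = top_cell x.
Proof.
rewrite /top_cell; case: ex_minnP => n nx minx xy; case: ex_minnP => m my miny.
have w1 : in_window n.+1 y by rewrite -addn1 -(in_window_cell _ xy)// addn1.
have -> : m = n.
  apply/eqP; rewrite eqn_leq miny//= leqNgt; apply/negP => mn.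
  case: n nx minx xy w1 mn => // n nx minx xy w1 mn.
  have : in_window n.+1 x.
    by rewrite -(addn0 n.+1) (in_window_cell _ xy)// addn0; apply: in_window_le my.
  by move=> /minx; rewrite ltnn.
by rewrite /cell_at; congr pair; exact: xy.
Qed.

(** In units of the side of the top cell, the coordinates of [x] are at most 2, those of [y] at most
    1, and the centre is within 1/2 of [x]. So [y] is within 7/2 of the centre in each coordinate,
    and the dilate reaches 9/2. *)
Lemma top_dilate x y : (forall i, `|tnth y i| <= 2 ^+ J) ->
  cube ((closed_cell (top_cell x)).1, 9 * (closed_cell (top_cell x)).2 : R) y.
Proof.
rewrite /top_cell; case: ex_minnP => n /forallP nx _ hy i; rewrite tnth_mktuple /=.
have /cellP/(_ i) := mem_cell_at (- (J + n)%N%:Z) x.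
rewrite /= side_neg intrD !mulrDr mulr1.
have := nx i; rewrite addnS exprS; have := hy i.
have : 2 ^+ J <= 2 ^+ (J + n) :> R by rewrite ler_weXn2l// ?ler1n// leq_addr.
move: (2 ^+ J) (2 ^+ (J + n)) => a b.
by move: (b * _) => t; rewrite !ler_norml; lra.
Qed.

End top_cell.

Variables (J : nat) (O : cellT -> set Rd).

Fixpoint chain (n : nat) x : option cellT :=
  if n is m.+1 then obind (fun Q => next_cell O Q x) (chain m x) else Some (top_cell J x).

Lemma chain_mem n x Q : chain n x = Some Q -> cell Q x.
Proof.
case: n => [|n] /=; first by move=> [<-]; exact: mem_top.
by case: (chain n x) => [P|] //= /next_mem.
Qed.

Lemma chain_const n x y Q : chain n x = Some Q -> cell Q y -> chain n y = Some Q.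
Proof.
elim: n Q => [|n IH] Q /=.
  by move=> [<-] xy; congr Some; exact: top_const.
case E : (chain n x) => [P|//] /= h Qy.
have Py : cell P y by apply: (next_sub (chain_mem E) h).
by rewrite (IH _ E Py) /=; exact: (next_const h Qy).
Qed.

Lemma chain_fiber n x Q : chain n x = Some Q -> chain n @^-1` [set Some Q] = cell Q.
Proof.
move=> h; apply/seteqP; split => y; first exact: chain_mem.
exact: (chain_const h).
Qed.

Lemma measurable_chain n t : measurable (chain n @^-1` [set t]).
Proof.
have mS P : measurable (chain n @^-1` [set Some P]).
  have [[x h]|nh] := pselect (exists x, chain n x = Some P).
    by rewrite (chain_fiber h); exact: measurable_cell.
  rewrite (_ : _ @^-1` _ = set0)//; apply/seteqP; split => // x h.
  by apply: nh; exists x.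
case: t => [P|]; first exact: mS.
rewrite (_ : _ @^-1` _ = ~` \bigcup_P chain n @^-1` [set Some P]).
  by apply: measurableC; exact: countable_bigcupT_measurable.
apply/seteqP; split => x /= => [h [P _ /=]|h]; first by rewrite h.
by case E : (chain n x) => [P|//]; exfalso; apply: h; exists P.
Qed.

Lemma chain_None m n x : (m <= n)%N -> chain m x = None -> chain n x = None.
Proof.
move=> mn h; elim: n mn => [|n IH]; first by rewrite leqn0 => /eqP <-.
by rewrite leq_eqVlt => /predU1P[<-//|]; rewrite ltnS => /IH /= ->.
Qed.

Lemma chain_level m n x P Q : (m < n)%N ->
  chain m x = Some P -> chain n x = Some Q -> P.1 < Q.1.
Proof.
move=> + hP; elim: n Q => // n IH Q; rewrite ltnS leq_eqVlt => /predU1P[<-|mn] /=.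
  by rewrite hP /=; exact: next_level.
case E : (chain n x) => [S|//] /= /next_level; exact: lt_trans (IH _ mn E).
Qed.

Lemma chain_sub n x P Q : chain 0 x = Some P -> chain n x = Some Q -> cell Q `<=` cell P.
Proof.
move=> hP; elim: n Q => [|n IH] Q; first by rewrite hP => -[<-].
rewrite /=; case E : (chain n x) => [S|//] /= h.
apply: subset_trans (IH _ E); exact: next_sub (chain_mem E) h.
Qed.

(** A cell determines its generation because levels strictly increase along a chain. Hence the sum
    over generations counts no cell of the family twice. *)
Lemma chain_index_inj m n x y Q : chain m x = Some Q -> chain n y = Some Q -> m = n.
Proof.
move=> hx hy; have {}hx := chain_const hx (chain_mem hy).
by apply/eqP; case: (ltngtP m n) => // mn;
  [have := chain_level mn hx hy|have := chain_level mn hy hx]; rewrite ltxx.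
Qed.

Definition in_chain : set cellT := [set Q | exists n x, chain n x = Some Q].

(** A common point would have both [P] and [Q] as the last cell of its chain. *)
Lemma in_chain_last_disjoint P Q : in_chain P -> in_chain Q -> P <> Q ->
  (cell P `&` next_cell O P @^-1` [set None]) `&` (cell Q `&` next_cell O Q @^-1` [set None]) = set0.
Proof.
move=> [m [x hx]] [n [y hy]] PQ; apply/seteqP; split => // z [[Pz Pn] [Qz Qn]].
have {}hx := chain_const hx Pz; have {}hy := chain_const hy Qz.
have hm : chain m.+1 z = None by rewrite /= hx.
have hn : chain n.+1 z = None by rewrite /= hy.
apply: PQ; case: (ltngtP m n) hx hy => mn hx hy.
- by move: (chain_None mn hm); rewrite hy.
- by move: (chain_None mn hn); rewrite hx.
- by move: hy; rewrite -mn hx => -[].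
Qed.

Hypothesis Oopen : forall Q, dopen (O Q).
Hypothesis Osmall : forall Q, (leb (O Q) <= (side Q.1 ^+ d / 2 ^+ d.+2)%:E)%E.

(** Each generation loses at least half of the measure, by [leb_next_le] on every cell of the
    previous one. *)
Lemma leb_chain_le n P :
  (leb ([set x | chain n x <> None] `&` chain 0 @^-1` [set Some P]) <=
   (side P.1 ^+ d / 2 ^+ n)%:E)%E.
Proof.
have [[x hx]|nh] := pselect (exists x, chain 0 x = Some P); last first.
  rewrite (_ : _ `&` _ = set0).
    by rewrite measure0 lee_fin divr_ge0// exprn_ge0// ltW// side_gt0.
  by apply/seteqP; split => // x [_ h]; apply: nh; exists x.
rewrite (chain_fiber hx).
have mN k : measurable [set x | chain k x <> None].
  exact: (fiber_measurable (measurable_chain k) [set t | t <> None]).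
have mP := @measurable_cell R d P.
elim: n => [|n IH].
  by rewrite expr0 divr1 -leb_cell; apply: leb_le => y [].
rewrite -(integral_indic _ mP (mN _)).
have -> : (side P.1 ^+ d / 2 ^+ n.+1)%:E = (2^-1%:E * (side P.1 ^+ d / 2 ^+ n)%:E)%E.
  by rewrite -EFinM exprS invfM mulrCA.
apply: (@le_trans _ _ (2^-1%:E * leb ([set x | chain n x <> None] `&` cell P))%E); last first.
  by apply: lee_wpmul2l.
rewrite -(integral_indic _ mP (mN _)) -ge0_integralZl_EFin//; last first.
  by apply/measurable_EFinP; exact: measurable_indic.
apply: (le_integral_fibers (measurable_chain n)) => //.
- by apply/measurable_EFinP; exact: measurable_indic.
- apply: measurable_funeM; apply/measurable_EFinP; exact: measurable_indic.
move=> t; have mF := measurable_chain n t; have mPF := measurableI _ _ mP mF.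
rewrite ge0_integralZl_EFin//; last first.
  by apply/measurable_EFinP; exact: measurable_indic.
rewrite !integral_indic//.
case: t mF mPF => [Q|] mF mPF; last first.
  rewrite (_ : _ `&` _ = set0) ?measure0 ?mule_ge0//.
  by apply/seteqP; split => // y [/= + [_ /= e]]; rewrite e.
have [[y [Py hy]]|nh] := pselect (exists y, cell P y /\ chain n y = Some Q); last first.
  rewrite (_ : _ `&` _ = set0) ?measure0 ?mule_ge0//.
  by apply/seteqP; split => // y [_ [Py h]]; apply: nh; exists y.
have sub : cell Q `<=` cell P.
  apply: chain_sub hy; exact: chain_const hx Py.
rewrite (chain_fiber hy) (_ : cell P `&` cell Q = cell Q); last exact/setIidPr.
rewrite (_ : [set x | chain n x <> None] `&` cell Q = cell Q); last first.
  by apply/setIidPr => z Qz /=; rewrite (chain_const hy Qz).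
rewrite [X in (_ * X)%E]leb_cell -EFinM mulrC; apply: le_trans (leb_next_le Oopen Osmall Q).
by apply: leb_le => z [/= + Qz]; rewrite (chain_const hy Qz).
Qed.

Definition infinite_chain : set Rd := \bigcap_n [set x | chain n x <> None].

Lemma measurable_infinite_chain : measurable infinite_chain.
Proof.
apply: bigcapT_measurable => n.
exact: (fiber_measurable (measurable_chain n) [set t | t <> None]).
Qed.

Lemma leb_infinite_chain : leb infinite_chain = 0%E.
Proof.
have m0 P : leb (infinite_chain `&` chain 0 @^-1` [set Some P]) = 0%E.
  apply/eqP; rewrite eq_le measure_ge0 andbT; apply/lee_addgt0Pr => e e0; rewrite add0e.
  pose n := Num.bound (side P.1 ^+ d / e).
  apply: (@le_trans _ _ (side P.1 ^+ d / 2 ^+ n)%:E).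
    apply: le_trans (leb_chain_le n P); apply: leb_le => x [xN xP].
    by split=> //; exact: xN.
  rewrite lee_fin ler_pdivrMr ?exprn_gt0// -ler_pdivrMl// mulrC.
  by apply: ltW; exact: upper_nthrootP.
have mi := measurable_infinite_chain.
rewrite -[infinite_chain]setIT -(integral_indic _ measurableT mi).
apply/eqP; rewrite eq_le (integral_ge0 _)// andbT.
apply: (@le_trans _ _ (\int[@leb R d]_x cst 0 x)%E); last by rewrite integral0.
apply: (le_integral_fibers (measurable_chain 0)) => //.
  by apply/measurable_EFinP; exact: measurable_indic.
move=> [P|].
  rewrite integral0 integral_indic//; last by rewrite setTI; exact: measurable_chain.
  by rewrite setTI; have /eqP := m0 P; rewrite eq_le => /andP[].
by rewrite (_ : _ `&` _ = set0) ?integral_set0//; apply/seteqP; split => // x [].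
Qed.

End chain.

(** * Orlicz averages and Hoelder's inequality *)

Section PhiL.
Context {R : realType} (beta : R).
Hypothesis beta0 : 0 <= beta.

Lemma ln_e_add_ge1 (t : R) : 0 <= t -> 1 <= ln (expR 1 + t).
Proof.
move=> t0; rewrite -[X in X <= _](expRK 1) ler_ln ?posrE ?expR_gt0//; first by lra.
by rewrite ltr_wpDr ?expR_gt0.
Qed.

Lemma PhiL_ge (t : R) : 0 <= t -> t <= PhiL beta t.
Proof.
move=> t0; rewrite /PhiL ler_peMr//; have e : 1 = 1 `^ beta :> R by rewrite powR1.
rewrite [X in X <= _]e.
by rewrite ge0_ler_powR// ?nnegrE ?ln_e_add_ge1// (le_trans ler01)// ln_e_add_ge1.
Qed.

Lemma PhiL_ge0 (t : R) : 0 <= t -> 0 <= PhiL beta t.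
Proof. by move=> t0; exact: le_trans (PhiL_ge t0). Qed.

Lemma PhiL_le (t u : R) : 0 <= t -> t <= u -> PhiL beta t <= PhiL beta u.
Proof.
move=> t0 tu; have u0 := le_trans t0 tu; rewrite /PhiL ler_pM ?powR_ge0//.
have ge0 (v : R) : 0 <= v -> 0 <= ln (expR 1 + v).
  by move=> v0; apply: le_trans (ln_e_add_ge1 v0).
by rewrite ge0_ler_powR// ?nnegrE ?ge0// ler_ln ?posrE ?ltr_wpDr ?expR_gt0// lerD2l.
Qed.

(** The logarithmic factor is increasing, so only the linear factor matters. This is how raising a
    level by a constant makes a modular small. *)
Lemma PhiL_div (K t : R) : 1 <= K -> 0 <= t -> PhiL beta (t / K) <= PhiL beta t / K.
Proof.
move=> K1 t0; have K0 : 0 < K by lra.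
have tK0 : 0 <= t / K by rewrite divr_ge0// ltW.
have tK : t / K <= t by rewrite ler_pdivrMr// ler_peMr.
rewrite /PhiL [leRHS]mulrAC ler_wpM2l ?divr_ge0 ?(ltW K0)//.
rewrite ge0_ler_powR ?nnegrE//.
- by apply: le_trans (ln_e_add_ge1 tK0).
- by apply: le_trans (ln_e_add_ge1 t0).
- by rewrite ler_ln ?posrE ?ltr_wpDr ?expR_gt0// lerD2l.
Qed.

Lemma measurable_PhiL : measurable_fun setT (PhiL beta).
Proof.
apply: measurable_funM => //.
apply: (measurableT_comp (measurable_powR beta)).
apply: (measurableT_comp (@measurable_ln R)).
exact: measurable_funD.
Qed.

End PhiL.

Section modular.
Context {R : realType} {d : nat}.
Local Notation Rd := (d.-tuple R).
Implicit Types (f g h : Rd -> R) (Q : Rd * R) (beta : R).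
Local Notation mu := (@leb R d).

Lemma vol_gt0 Q : is_cube Q -> 0 < vol Q.
Proof. by move=> Q0; rewrite exprn_gt0. Qed.

Lemma measurable_PhiL_comp beta lam f : measurable_fun setT f ->
  measurable_fun setT (fun x => (PhiL beta (`|f x| / lam))%:E).
Proof.
move=> mf; apply/measurable_EFinP; apply: (measurableT_comp (measurable_PhiL beta)).
by apply: measurable_funM => //; exact: measurableT_comp.
Qed.

Lemma LlogL_norm_ge0 beta f Q : (0 <= LlogL_norm beta f Q)%E.
Proof. by apply: le_ereal_inf_tmp => _ [lam [l0 _] <-]; rewrite lee_fin ltW. Qed.

(* The factor 2 makes it irrelevant whether the infimum in the norm is attained. *)
Lemma LlogL_norm_modular beta f Q (N K : R) : 0 <= beta -> is_cube Q ->
  measurable_fun setT f -> LlogL_norm beta f Q = N%:E -> 0 < N -> 1 <= K ->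
  (\int[mu]_(x in cube Q) (PhiL beta (`|f x| / (K * (2 * N))))%:E <= (vol Q / K)%:E)%E.
Proof.
move=> b0 Q0 mf hN N0 K1; have K0 : 0 < K by lra.
have vQ := vol_gt0 Q0; have mQ := measurable_cube Q.
have [_ [lam [l0 hl] <-]] : exists2 y, [set lam%:E | lam in [set lam : R | 0 < lam /\
     ((vol Q)^-1%:E * \int[mu]_(x in cube Q) (PhiL beta (`|f x| / lam))%:E <= 1)%E]] y
     & (y < (2 * N)%:E)%E.
  by apply: ereal_inf_lt; rewrite -/(LlogL_norm beta f Q) hN lte_fin; lra.
rewrite lte_fin => l2N.
have {}hl : (\int[mu]_(x in cube Q) (PhiL beta (`|f x| / lam))%:E <= (vol Q)%:E)%E.
  by move: hl; rewrite muleC lee_pdivrMr// mul1e.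
apply: (@le_trans _ _ (\int[mu]_(x in cube Q) (K^-1%:E * (PhiL beta (`|f x| / lam))%:E))%E).
  apply: ge0_le_integral => //.
  - by move=> x _; rewrite lee_fin PhiL_ge0// divr_ge0//; nra.
  - by apply: measurable_funTS; exact: measurable_PhiL_comp.
  - by apply: measurable_funTS; apply: measurable_funeM; exact: measurable_PhiL_comp.
  move=> x _; rewrite -EFinM lee_fin [leRHS]mulrC.
  have fl : 0 <= `|f x| / lam by rewrite divr_ge0// ltW.
  apply: le_trans (PhiL_div b0 K1 fl).
  have h : `|f x| / (2 * N) <= `|f x| / lam.
    by rewrite ler_wpM2l// lef_pV2 ?posrE//; lra.
  have e : `|f x| / (K * (2 * N)) = `|f x| / (2 * N) / K.
    by rewrite invfM mulrA mulrAC.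
  rewrite e PhiL_le// ?divr_ge0//; [lra|exact: ltW|].
  by rewrite ler_wpM2r// invr_ge0 ltW.
rewrite ge0_integralZl_EFin//.
- rewrite mulrC EFinM; apply: lee_wpmul2l => //; rewrite lee_fin invr_ge0; exact: ltW.
- by move=> x _; rewrite lee_fin PhiL_ge0// divr_ge0// ltW.
- by apply: measurable_funTS; exact: measurable_PhiL_comp.
- by rewrite invr_ge0 ltW.
Qed.

(** Arbitrarily small [lam] are admissible, and [PhiL_ge] bounds the integral of [|f|] over the cube
    by [lam] times its volume. *)
Lemma LlogL_norm_eq0 beta f Q : 0 <= beta -> is_cube Q ->
  measurable_fun setT f -> LlogL_norm beta f Q = 0%E ->
  (\int[mu]_(x in cube Q) `|f x|%:E = 0)%E.
Proof.
move=> b0 Q0 mf h0; apply/eqP; rewrite eq_le integral_ge0// andbT.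
have vQ := vol_gt0 Q0; have mQ := measurable_cube Q.
have mf' : measurable_fun setT (fun x => `|f x|%:E).
  by apply/measurable_EFinP; exact: measurableT_comp.
apply/lee_addgt0Pr => e e0; rewrite add0e.
have [_ [lam [l0 hl] <-]] : exists2 y, [set lam%:E | lam in [set lam : R | 0 < lam /\
     ((vol Q)^-1%:E * \int[mu]_(x in cube Q) (PhiL beta (`|f x| / lam))%:E <= 1)%E]] y
     & (y < (e / vol Q)%:E)%E.
  by apply: ereal_inf_lt; rewrite -/(LlogL_norm beta f Q) h0 lte_fin divr_gt0.
rewrite lte_fin ltr_pdivlMr// => le.
have {}hl : (\int[mu]_(x in cube Q) (PhiL beta (`|f x| / lam))%:E <= (vol Q)%:E)%E.
  by move: hl; rewrite muleC lee_pdivrMr// mul1e.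
apply: (@le_trans _ _ (\int[mu]_(x in cube Q) (lam%:E * (PhiL beta (`|f x| / lam))%:E))%E).
  apply: ge0_le_integral => //.
  - exact: measurable_funTS.
  - by apply: measurable_funTS; apply: measurable_funeM; exact: measurable_PhiL_comp.
  move=> x _; rewrite -EFinM lee_fin [leRHS]mulrC -ler_pdivrMr//.
  by apply: PhiL_ge => //; rewrite divr_ge0// ltW.
rewrite ge0_integralZl_EFin//.
- apply: (@le_trans _ _ (lam%:E * (vol Q)%:E)%E); last by rewrite -EFinM lee_fin ltW.
  by apply: lee_wpmul2l => //; rewrite lee_fin ltW.
- by move=> x _; rewrite lee_fin PhiL_ge0// divr_ge0// ltW.
- by apply: measurable_funTS; exact: measurable_PhiL_comp.
- exact: ltW.
Qed.

Lemma LlogL_norm_fin beta f Q : 0 <= beta -> is_cube Q -> measurable_fun setT f ->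
  (exists M : R, forall x, `|f x| <= M) -> LlogL_norm beta f Q \is a fin_num.
Proof.
move=> b0 Q0 mf [M fM]; rewrite ge0_fin_numE ?LlogL_norm_ge0//.
have vQ := vol_gt0 Q0; have mQ := measurable_cube Q.
pose B := PhiL beta 1; have B1 : 1 <= B by apply: PhiL_ge.
(* With this level the argument of [PhiL] is at most 1 / B, and [PhiL_div] brings its value below
   [PhiL beta 1 / B], which is 1. *)
pose lam := B * (1 + `|M|); have M0 : 0 < 1 + `|M| by rewrite ltr_wpDr.
have l0 : 0 < lam by rewrite mulr_gt0//; lra.
apply: (@le_lt_trans _ _ lam%:E); last by rewrite ltry.
apply: ereal_inf_lbound; exists lam => //; split => //.
rewrite muleC lee_pdivrMr// mul1e -leb_cube//.
rewrite -[leRHS]mul1e -(integral_cst mu mQ 1).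
apply: ge0_le_integral => //.
- by move=> x _; rewrite lee_fin PhiL_ge0// divr_ge0// ltW.
- by apply: measurable_funTS; exact: measurable_PhiL_comp.
move=> x _; rewrite lee_fin.
have -> : `|f x| / lam = `|f x| / (1 + `|M|) / B by rewrite /lam invfM mulrA mulrAC.
have f1 : `|f x| / (1 + `|M|) <= 1.
  by rewrite ler_pdivrMr// mul1r (le_trans (fM x))// (le_trans (ler_norm M))// lerDr.
have f0 : 0 <= `|f x| / (1 + `|M|) by rewrite divr_ge0// ltW.
apply: le_trans (PhiL_div b0 B1 f0) _.
by rewrite ler_pdivrMr ?mul1r ?PhiL_le//; lra.
Qed.

(** Choosing the level proportional to [a] cancels the constant of the weak type bound, which then
    survives only as a factor of the level. *)
Lemma modular_indic beta a rho f Q : 0 <= beta -> 0 < a ->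
  modular beta a (a * rho) (fun x => f x * \1_(cube Q) x) =
  (\int[mu]_(x in cube Q) (PhiL beta (`|f x| / rho))%:E)%E.
Proof.
move=> b0 a0; rewrite /modular [RHS]integral_mkcond; apply: eq_integral => x _.
have e (z : R) : a * z / (a * rho) = z / rho.
  by rewrite invfM mulrACA mulfV ?mul1r// gt_eqF.
rewrite e patchE indicE; case: (x \in cube Q); first by rewrite mulr1.
by rewrite mulr0 normr0 mul0r /PhiL mul0r.
Qed.

End modular.

(** * Hoelder's inequality for the terms of the sparse form *)

Section hoelder_cube.
Context {R : realType} {d : nat}.
Local Notation Rd := (d.-tuple R).
Implicit Types (f g h w : Rd -> R) (Q : Rd * R) (D : set Rd).
Local Notation mu := (@leb R d).

Lemma measurable_norm_powR p f : measurable_fun setT f ->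
  measurable_fun setT (fun x => (`|f x| `^ p)%:E).
Proof.
move=> mf; apply/measurable_EFinP; apply: (measurableT_comp (measurable_powR p)).
exact: measurableT_comp.
Qed.

Lemma poweR_le (p : R) (x y : \bar R) : 0 <= p -> (0 <= x)%E -> (x <= y)%E ->
  (poweR x p <= poweR y p)%E.
Proof.
move=> p0 x0 xy; apply: gt0_ler_poweR => //; rewrite in_itv/= leey andbT//.
exact: le_trans xy.
Qed.

Lemma poweR_invK (p : R) (x : \bar R) : 0 < p -> (0 <= x)%E ->
  poweR (poweR x p^-1) p = x.
Proof.
by move=> p0 x0; rewrite -poweRrM mulVf ?gt_eqF// poweRe1.
Qed.

Lemma hoelder_on D f g (p q : R) : measurable D ->
  measurable_fun setT f -> measurable_fun setT g ->
  0 < p -> 0 < q -> p^-1 + q^-1 = 1 ->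
  (\int[mu]_(x in D) `|f x * g x|%:E <=
   poweR (\int[mu]_(x in D) (`|f x| `^ p)%:E) p^-1 *
   poweR (\int[mu]_(x in D) (`|g x| `^ q)%:E) q^-1)%E.
Proof.
move=> mD mf mg p0 q0 pq.
have mi : measurable_fun setT (\1_D : Rd -> R) by exact: measurable_indic.
have := hoelder mu (measurable_funM mf mi) (measurable_funM mg mi) p0 q0 pq.
have e (h : Rd -> R) (r : R) : 0 < r ->
    (\int[mu]_x (poweR `|(h x * \1_D x)%:E| r) = \int[mu]_(x in D) (`|h x| `^ r)%:E)%E.
  move=> r0; rewrite [RHS]integral_mkcond; apply: eq_integral => x _ /=.
  rewrite patchE indicE; case: (x \in D); first by rewrite mulr1.
  by rewrite mulr0 normr0 powR0// gt_eqF.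
rewrite unlock /= !e//.
rewrite (@invr1 R) poweRe1; last first.
  by apply: integral_ge0 => x _; rewrite lee_fin powR_ge0.
apply: le_trans; rewrite [leLHS]integral_mkcond le_eqVlt; apply/orP; left.
apply/eqP; apply: eq_integral => x _ /=.
rewrite patchE indicE /=; case: (x \in D); last by rewrite !mulr0 normr0 powR0// oner_neq0.
by rewrite !mulr1 powRr1.
Qed.

Lemma poweR_avg (r s v : R) (I : \bar R) : 0 < v -> 0 < r -> 0 < s -> r^-1 + s^-1 = 1 ->
  (0 <= I)%E ->
  ((v `^ s^-1)%:E * poweR I r^-1 = v%:E * poweR (v^-1%:E * I) r^-1)%E.
Proof.
move=> v0 r0 s0 rs I0; have vi : (0 <= v^-1%:E)%E by rewrite lee_fin invr_ge0 ltW.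
rewrite poweRM// poweR_EFin muleA -EFinM; congr (_%:E * _)%E.
rewrite -[v^-1]powR_inv1 ?(ltW v0)// -powRrM mulN1r -[X in X * _]powRr1 ?(ltW v0)//.
rewrite -powRD ?(gt_eqF v0) ?implybT//; congr (_ `^ _).
by rewrite -rs addrAC subrr add0r.
Qed.

(* The factor [|Q|^(1/s)] from the hypothesis turns the [L^r] norm of [g] into
   [|Q|] times its average. *)
Lemma hoelder_sparse_term D Q w g (r s lam : R) : measurable D -> is_cube Q -> D `<=` cube Q ->
  measurable_fun setT w -> measurable_fun setT g ->
  0 < r -> 0 < s -> r^-1 + s^-1 = 1 -> 0 <= lam ->
  (\int[mu]_(x in D) (`|w x| `^ s)%:E <= (lam `^ s * vol Q)%:E)%E ->
  (\int[mu]_(x in D) `|w x * g x|%:E <= lam%:E * ((vol Q)%:E * avg_r r g Q))%E.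
Proof.
move=> mD Q0 DQ mw mg r0 s0 rs l0 h; have vQ : 0 < vol Q by rewrite exprn_gt0.
have sr : s^-1 + r^-1 = 1 by rewrite addrC.
apply: le_trans (hoelder_on mD mw mg s0 r0 sr) _.
rewrite /avg_r -(poweR_avg vQ r0 s0 rs); last by apply: integral_ge0 => x _; rewrite lee_fin powR_ge0.
rewrite muleA; apply: lee_pmul; try exact: poweR_ge0.
  apply: le_trans (poweR_le _ _ h) _; first by rewrite invr_ge0 ltW.
    by apply: integral_ge0 => x _; rewrite lee_fin powR_ge0.
  rewrite poweR_EFin powRM ?powR_ge0 ?(ltW vQ)// -powRrM mulfV ?gt_eqF// powRr1//.
apply: poweR_le; first by rewrite invr_ge0 ltW.
  by apply: integral_ge0 => x _; rewrite lee_fin powR_ge0.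
apply: ge0_subset_integral => //; first exact: measurable_cube.
  by apply: measurable_funTS; exact: measurable_norm_powR.
Qed.

Lemma normp_le_integral_le (p c : R) (f h : Rd -> R) : 0 < p -> 0 <= c ->
  (normp p h <= c%:E * normp p f)%E ->
  (\int[mu]_x (`|h x| `^ p)%:E <= (c `^ p)%:E * \int[mu]_x (`|f x| `^ p)%:E)%E.
Proof.
move=> p0 c0; have i0 (k : Rd -> R) : (0 <= \int[mu]_x (`|k x| `^ p)%:E)%E.
  by apply: integral_ge0 => x _; rewrite lee_fin powR_ge0.
rewrite /normp => /(poweR_le (ltW p0) (poweR_ge0 _ _)).
by rewrite poweR_invK// poweRM ?poweR_ge0// poweR_invK// poweR_EFin.
Qed.

Lemma not_bad_integral_le (s lam : R) Q h : 0 < s -> 0 <= lam -> is_cube Q ->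
  (((vol Q) `^ (- s^-1))%:E * normp_on s Q h <= lam%:E)%E ->
  (\int[mu]_(x in cube Q) (`|h x| `^ s)%:E <= (lam `^ s * vol Q)%:E)%E.
Proof.
move=> s0 l0 Q0; have vQ : 0 < vol Q by rewrite exprn_gt0.
have i0 : (0 <= \int[mu]_(x in cube Q) (`|h x| `^ s)%:E)%E.
  by apply: integral_ge0 => x _; rewrite lee_fin powR_ge0.
rewrite /normp_on => hl.
have := poweR_le (ltW s0) (mule_ge0 _ (poweR_ge0 _ _)) hl.
rewrite lee_fin powR_ge0 => /(_ isT).
rewrite poweRM ?lee_fin ?powR_ge0 ?poweR_ge0// poweR_invK// !poweR_EFin -powRrM mulNr.
rewrite mulVf ?gt_eqF// powR_inv1 ?(ltW vQ)// lee_pdivrMl// => h1.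
by rewrite mulrC EFinM.
Qed.

End hoelder_cube.

(** * Linear operators and exceptional sets *)

Section operators.
Context {R : realType} {d : nat}.
Local Notation Rd := (d.-tuple R).
Local Notation mu := (@leb R d).
Implicit Types (f h : Rd -> R) (T : (Rd -> R) -> (Rd -> R)).

Lemma Lp_indic p h (E : set Rd) : 0 < p -> measurable E -> Lp p h ->
  Lp p (fun y => h y * \1_E y).
Proof.
move=> p0 mE [mh hoo]; have mhE : measurable_fun setT (fun y => h y * \1_E y).
  by apply: measurable_funM => //; exact: measurable_indic.
split; [exact: mhE|apply: le_lt_trans hoo].
apply: ge0_le_integral => //.
- exact: measurable_norm_powR.
- exact: measurable_norm_powR.
move=> x _; rewrite lee_fin ge0_ler_powR ?nnegrE ?(ltW p0)//.
by rewrite normrM ler_piMr// ger0_norm ?indicE// lern1 leq_b1.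
Qed.

Lemma Lunion_indic h (E : set Rd) : measurable E -> Lunion h ->
  Lunion (fun y => h y * \1_E y).
Proof.
move=> mE [p [p1 hp]]; exists p; split; first exact: p1.
exact: (Lp_indic (lt_le_trans ltr01 p1) mE hp).
Qed.

Lemma Lunion_cube f (Q : Rd * R) : is_cube Q -> measurable_fun setT f ->
  (exists M : R, forall x, `|f x| <= M) -> Lunion (fun y => f y * \1_(cube Q) y).
Proof.
move=> Q0 mf [M fM]; have mQ := measurable_cube Q.
exists 1; split => //; split.
  by apply: measurable_funM => //; exact: measurable_indic.
apply: (@le_lt_trans _ _ (\int[mu]_x (`|M|%:E * (\1_(cube Q) x)%:E))%E).
  apply: ge0_le_integral => //.
  - by apply: measurable_norm_powR; apply: measurable_funM => //; exact: measurable_indic.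
  - by apply: measurable_funeM; apply/measurable_EFinP; exact: measurable_indic.
  move=> x _; rewrite -EFinM lee_fin powRr1// normrM ler_pM//.
    exact: le_trans (fM x) (ler_norm M).
  by rewrite indicE; case: (x \in cube Q); rewrite ?normr1 ?normr0.
rewrite ge0_integralZl_EFin//; last first.
  by apply/measurable_EFinP; exact: measurable_indic.
by rewrite integral_indic// setIT [X in (_ * X)%E]leb_cube// -EFinM ltry.
Qed.

Lemma ae_RdW (P P' : Rd -> Prop) : (forall x, P x -> P' x) -> ae_Rd P -> ae_Rd P'.
Proof.
by move=> h [N [mN N0 PN]]; exists N; split => // x nP'; apply: PN => /h.
Qed.

Lemma ae_RdI (P P' : Rd -> Prop) : ae_Rd P -> ae_Rd P' -> ae_Rd (fun x => P x /\ P' x).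
Proof.
move=> [N [mN N0 PN]] [N' [mN' N'0 PN']]; exists (N `|` N'); split.
- exact: measurableU.
- by rewrite measureU0.
- move=> x /= nPP; have [Px|nPx] := pselect (P x); [right|left; exact: PN].
  by apply: PN' => P'x; apply: nPP.
Qed.

Lemma lin_op_add T : lin_op T -> forall f g h, Lunion f -> Lunion g ->
  (forall x, h x = f x + g x) -> ae_Rd (fun x => T h x = T f x + T g x).
Proof.
move=> [_ lin _] f g h Lf Lg hE; have := lin f g 1 1 Lf Lg.
have -> : (fun y => 1 * f y + 1 * g y) = h.
  by apply/funext => y; rewrite hE !mul1r.
by apply: ae_RdW => x ->; rewrite !mul1r.
Qed.

Lemma lin_op_ae0 T : lin_op T -> forall h, Lunion h -> ae_Rd (fun x => h x = 0) ->
  ae_Rd (fun x => T h x = 0).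
Proof.
move=> [_ lin cong] h Lh h0; have e := lin h h 0 0 Lh Lh.
(* The zero function, written as a combination so that linearity gives [T z = 0] almost
   everywhere. *)
set z := (fun y => 0 * h y + 0 * h y) in e.
have L0 : Lunion z.
  have [p [p1 [mh hoo]]] := Lh; exists p; split; [exact: p1|split].
    by rewrite /z; apply: measurable_funD; apply: measurable_funM.
  under eq_integral do rewrite /z !mul0r addr0 normr0 powR0 ?gt_eqF// ?(lt_le_trans _ p1)//.
  by rewrite integral0.
have hz : ae_Rd (fun x => h x = z x).
  by apply: ae_RdW h0 => x ->; rewrite /z !mul0r addr0.
apply: ae_RdW (ae_RdI e (cong _ _ Lh L0 hz)) => x [ex ->].
by rewrite ex !mul0r addr0.
Qed.

Lemma ae0_integral (p : R) h (D : set Rd) : 0 < p -> measurable D -> measurable_fun setT h ->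
  ae_Rd (fun x => h x = 0) -> (\int[mu]_(x in D) (`|h x| `^ p)%:E = 0)%E.
Proof.
move=> p0 mD mh [N [mN N0 hN]].
rewrite (@ge0_ae_eq_integral _ _ _ mu D _ (cst 0%E)) ?integral0//.
- by apply: measurable_funTS; exact: measurable_norm_powR.
- by exists N; split => // x /= /not_implyP[_ nx]; apply: hN => /= hx; apply: nx;
    rewrite hx normr0 powR0// gt_eqF.
Qed.

Lemma Lunion_ae h h' : Lunion h -> measurable_fun setT h' ->
  ae_Rd (fun x => h x = h' x) -> Lunion h'.
Proof.
move=> [p [p1 [mh hoo]]] mh' [N [mN N0 hN]]; exists p.
split; [exact: p1|split; [exact: mh'|]].
rewrite -(@ge0_ae_eq_integral _ _ _ mu setT (fun x => (`|h x| `^ p)%:E))//.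
- exact: measurable_norm_powR.
- exact: measurable_norm_powR.
- by exists N; split => // x /= /not_implyP[_ nx]; apply: hN => /= hx; apply: nx; rewrite hx.
Qed.

End operators.

(** * Localised operators and the exceptional set of a cell *)

Section exceptional_set.
Context {R : realType} {d : nat}.
Local Notation Rd := (d.-tuple R).
Local Notation cellT := (int * d.-tuple int)%type.
Local Notation cell := (@cell R d).
Local Notation side := (@side R).
Local Notation mu := (@leb R d).
Implicit Types (x y : Rd) (P Q : cellT).

Definition three P : Rd * R := dil3 (closed_cell P).
(** The third term of the decomposition lives on [three P], and the maximal operator of [T2] on that
    cube truncates outside its triple; hence the factor 9. *)
Definition nine P : Rd * R := dil3 (three P).

Lemma is_cube_closed_cell P : is_cube (closed_cell P : Rd * R).
Proof. exact: side_gt0. Qed.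

Lemma is_cube_three P : is_cube (three P).
Proof. by apply: mulr_gt0 => //; exact: side_gt0. Qed.

Lemma is_cube_nine P : is_cube (nine P).
Proof. by apply: mulr_gt0 => //; exact: is_cube_three. Qed.

Lemma vol_three P : vol (three P) = 3 ^+ d * side P.1 ^+ d.
Proof. by rewrite /vol /= exprMn. Qed.

Lemma vol_nine P : vol (nine P) = 9 ^+ d * side P.1 ^+ d.
Proof. by rewrite /vol /= mulrA exprMn; congr (_ ^+ d * _); lra. Qed.

Lemma cell_sub_three P : cell P `<=` cube (three P).
Proof.
move=> x /cell_sub_cube h i; apply: le_trans (h i) _.
have := side_gt0 (R := R) P.1; rewrite /= ; lra.
Qed.

Lemma cell_sub_nine P : cell P `<=` cube (nine P).
Proof.
move=> x /cell_sub_three h i; apply: le_trans (h i) _.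
have := side_gt0 (R := R) P.1; rewrite /= ; lra.
Qed.

Lemma nine_sub P Q : cell P `<=` cell Q -> cube (nine P) `<=` cube (nine Q).
Proof.
move=> PQ; have := @cube_dilate_sub R d P Q 9 _ PQ.
rewrite /nine /three /dil3 /= !mulrA (_ : 3 * 3 = 9 :> R); last by lra.
by apply; lra.
Qed.

Variables (T1 T2 : (Rd -> R) -> (Rd -> R)) (f : Rd -> R).

Definition loc Q : Rd -> R := fun y => f y * \1_(cube (nine Q)) y.
Definition locT Q : Rd -> R := T1 (T2 (loc Q)).
(** [farT1 Q P] and [farT2 Q P] are the functions whose averages over [closed_cell P] and [three P]
    occur in [Mop] of [T1] at [T2 (loc Q)] and of [T2] at [loc Q]. *)
Definition farT1 Q P : Rd -> R :=
  T1 (fun y => T2 (loc Q) y * \1_(~` cube (three P)) y).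
Definition farT2 Q P : Rd -> R := T2 (fun y => loc Q y * \1_(~` cube (nine P)) y).
Definition nearT1 Q P : Rd -> R := T1 (fun y => farT2 Q P y * \1_(cube (three P)) y).

Variables (s beta1 beta2 C0 A A0 A1 A2 : R).

(** In [kbig], the factor 9^d is the volume ratio of [nine Q] to [Q], and 2^(d+4) the required
    smallness. In [kappa], the 2 comes from the infimum in the norm and 3^d from the volume ratio of
    [three P] to [P]. *)
Definition kbig : R := 1 + C0 * 9 ^+ d * 2 ^+ d.+4.
Definition kappa : R := 2 * kbig * 3 ^+ d.

Hypothesis s1 : 1 <= s.
Hypotheses (b10 : 0 <= beta1) (b20 : 0 <= beta2) (C00 : 0 < C0).
Hypotheses (A_gt0 : 0 < A) (A0_gt0 : 0 < A0) (A1_gt0 : 0 < A1) (A2_gt0 : 0 < A2).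
Hypotheses (lin1 : lin_op T1) (lin2 : lin_op T2).
Hypothesis L2 : forall h, Lunion h -> Lunion (T2 h).
Hypothesis strong : forall h, Lp s h -> (normp s (T1 h) <= A%:E * normp s h)%E.
Hypothesis weak0 : forall h (lam : R), Lunion h -> 0 < lam ->
  (mu [set x | (lam < `|T1 (T2 h) x|)%R] <= C0%:E * modular beta1 A0 lam h)%E.
Hypothesis weak1 : forall h (lam : R), Lunion h -> 0 < lam ->
  (mu [set x | lam%:E < Mop T1 s (T2 h) x] <= C0%:E * modular beta1 A1 lam h)%E.
Hypothesis weak2 : forall h (lam : R), Lunion h -> 0 < lam ->
  (mu [set x | lam%:E < Mop T2 s h x] <= C0%:E * modular beta2 A2 lam h)%E.
Hypotheses (mf : measurable_fun setT f) (bf : exists M : R, forall x, `|f x| <= M).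

Lemma kbig_ge1 : 1 <= kbig.
Proof. by rewrite /kbig lerDl mulr_ge0 ?exprn_ge0// mulr_ge0 ?exprn_ge0// ltW. Qed.

Lemma three_pow_ge1 : 1 <= 3 ^+ d :> R.
Proof. by rewrite exprn_ege1//; lra. Qed.

Lemma kappa_gt0 : 0 < kappa.
Proof. by have := kbig_ge1; have := three_pow_ge1; rewrite /kappa; nra. Qed.

Lemma Lunion_loc Q : Lunion (loc Q).
Proof. exact: Lunion_cube (is_cube_nine Q) mf bf. Qed.

Lemma Lunion_T2loc Q : Lunion (T2 (loc Q)).
Proof. exact: L2 (Lunion_loc Q). Qed.

Let mthree P : measurable (cube (three P)). Proof. exact: measurable_cube. Qed.
Let mnine P : measurable (cube (nine P)). Proof. exact: measurable_cube. Qed.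

Lemma Lunion_far1 Q P : Lunion (fun y => T2 (loc Q) y * \1_(~` cube (three P)) y).
Proof. by apply: Lunion_indic (Lunion_T2loc Q); exact: measurableC. Qed.

Lemma Lunion_near1 Q P : Lunion (fun y => T2 (loc Q) y * \1_(cube (three P)) y).
Proof. by apply: Lunion_indic (Lunion_T2loc Q). Qed.

Lemma Lunion_far2 Q P : Lunion (fun y => loc Q y * \1_(~` cube (nine P)) y).
Proof. by apply: Lunion_indic (Lunion_loc Q); exact: measurableC. Qed.

Lemma Lunion_nearT1_arg Q P : Lunion (fun y => farT2 Q P y * \1_(cube (three P)) y).
Proof. by apply: Lunion_indic => //; apply: L2; exact: Lunion_far2. Qed.

Lemma measurable_locT Q : measurable_fun setT (locT Q).
Proof. by have [m _ _] := lin1; apply: m; exact: Lunion_T2loc. Qed.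

Lemma measurable_farT1 Q P : measurable_fun setT (farT1 Q P).
Proof. by have [m _ _] := lin1; apply: m; exact: Lunion_far1. Qed.

Lemma measurable_nearT1 Q P : measurable_fun setT (nearT1 Q P).
Proof. by have [m _ _] := lin1; apply: m; exact: Lunion_nearT1_arg. Qed.

Lemma measurable_farT2 Q P : measurable_fun setT (farT2 Q P).
Proof. by have [m _ _] := lin2; apply: m; exact: Lunion_far2. Qed.

(** Both [locT Q] and [locT P] are split at [three P] and subtracted. The near parts differ by
    [nearT1 Q P], because [nine P] lies in [nine Q] and so [loc Q] minus [loc P] is [loc Q] cut off
    outside [nine P]. *)
Lemma locT_split Q P : cell P `<=` cell Q ->
  ae_Rd (fun x => locT Q x = farT1 Q P x - farT1 P P x + nearT1 Q P x + locT P x).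
Proof.
move=> PQ.
have split1 S : ae_Rd (fun x => locT S x =
    T1 (fun y => T2 (loc S) y * \1_(cube (three P)) y) x + farT1 S P x).
  apply: (lin_op_add lin1 (Lunion_near1 S P) (Lunion_far1 S P)) => x.
  rewrite -mulrDr !indicE in_setC; case: (x \in _) => /=; rewrite ?addr0 ?add0r mulr1//.
have split2 : ae_Rd (fun x => T2 (loc Q) x = T2 (loc P) x + farT2 Q P x).
  apply: (lin_op_add lin2 (Lunion_loc P) (Lunion_far2 Q P)) => x.
  rewrite /loc !indicE in_setC; have [/set_mem/(nine_sub PQ)/mem_set ->|_] := boolP (x \in cube (nine P)).
    by rewrite /= !mulr1 mulr0 addr0.
  by rewrite /= mulr0 mulr1 add0r.
have sum := lin_op_add lin1 (Lunion_near1 P P) (Lunion_nearT1_arg Q P) (fun x => erefl).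
have [_ _ cong] := lin1.
have {}sum : ae_Rd (fun x => T1 (fun y => T2 (loc Q) y * \1_(cube (three P)) y) x =
    T1 (fun y => T2 (loc P) y * \1_(cube (three P)) y) x + nearT1 Q P x).
  (* The splitting of [T2 (loc Q)] holds only almost everywhere. To apply [T1] to it, the sum has to
     be in its domain, and then [T1] respects almost everywhere equality. *)
  have LS : Lunion (fun y => T2 (loc P) y * \1_(cube (three P)) y +
                    farT2 Q P y * \1_(cube (three P)) y).
    apply: (Lunion_ae (Lunion_near1 Q P)).
      apply: measurable_funD; first by have [p [_ []]] := Lunion_near1 P P.
      by have [p [_ []]] := Lunion_nearT1_arg Q P.
    by apply: ae_RdW split2 => x ->; rewrite mulrDl.
  have h := cong _ _ (Lunion_near1 Q P) LS.
  apply: ae_RdW (ae_RdI sum (h _)) => [x [e1 ->]|]; first by rewrite e1.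
  by apply: ae_RdW split2 => x ->; rewrite mulrDl.
apply: ae_RdW (ae_RdI (ae_RdI (split1 Q) (split1 P)) sum) => x [[-> ->] ->]; ring.
Qed.

Definition norm1 Q : R := fine (LlogL_norm beta1 f (nine Q)).
Definition norm2 Q : R := fine (LlogL_norm beta2 f (nine Q)).

Lemma norm1E Q : LlogL_norm beta1 f (nine Q) = (norm1 Q)%:E.
Proof. by rewrite fineK// LlogL_norm_fin//; exact: is_cube_nine. Qed.

Lemma norm2E Q : LlogL_norm beta2 f (nine Q) = (norm2 Q)%:E.
Proof. by rewrite fineK// LlogL_norm_fin//; exact: is_cube_nine. Qed.

Lemma norm1_ge0 Q : 0 <= norm1 Q. Proof. exact/fine_ge0/LlogL_norm_ge0. Qed.
Lemma norm2_ge0 Q : 0 <= norm2 Q. Proof. exact/fine_ge0/LlogL_norm_ge0. Qed.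

Lemma small_modular (beta a N : R) Q : 0 <= beta -> 0 < a -> 0 < N ->
  LlogL_norm beta f (nine Q) = N%:E ->
  (C0%:E * modular beta a (a * (kbig * (2 * N))) (loc Q) <=
   (side Q.1 ^+ d / 2 ^+ d.+4)%:E)%E.
Proof.
move=> b0 a0 N0 hN; have K1 := kbig_ge1.
rewrite /loc modular_indic//.
have h := LlogL_norm_modular b0 (is_cube_nine Q) mf hN N0 K1.
apply: (@le_trans _ _ (C0%:E * (vol (nine Q) / kbig)%:E)%E).
  by apply: lee_wpmul2l => //; rewrite lee_fin ltW.
rewrite vol_nine -EFinM lee_fin mulrA ler_pdivrMr; last by lra.
rewrite mulrAC ler_pdivlMr ?exprn_gt0//.
have : 0 <= side Q.1 ^+ d by rewrite exprn_ge0// ltW// side_gt0.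
rewrite /kbig; move: (side _ ^+ d) => S S0; rewrite mulrDr mulr1.
have -> : C0 * (9 ^+ d * S) * 2 ^+ d.+4 = S * (C0 * 9 ^+ d * 2 ^+ d.+4) by ring.
by rewrite lerDr.
Qed.

Lemma level_ge0 (a N : R) : 0 < a -> 0 <= N -> 0 <= a * (kbig * (2 * N)).
Proof.
move=> a0 N0; apply: mulr_ge0; first exact: ltW.
by apply: mulr_ge0; [exact: le_trans ler01 kbig_ge1|exact: mulr_ge0].
Qed.

(** The bound on [locT] is an integral bound rather than a pointwise one, so that the empty set
    qualifies when everything vanishes almost everywhere. The last two clauses include [P = Q]. *)
Definition exceptional Q (O : set Rd) : Prop :=
  [/\ dopen O,
      (leb O <= (side Q.1 ^+ d / 2 ^+ d.+2)%:E)%E,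
      (forall X, measurable X -> X `<=` cell Q `\` O ->
        (\int[mu]_(x in X) (`|locT Q x| `^ s)%:E <=
           ((kappa * A0 * norm1 Q) `^ s)%:E * mu X)%E),
      (forall P, cell P `<=` cell Q -> ~ cell P `<=` O ->
        (\int[mu]_(x in cell P) (`|farT1 Q P x| `^ s)%:E <=
           ((kappa * A1 * norm1 Q) `^ s)%:E * mu (cell P))%E)
    & (forall P, cell P `<=` cell Q -> ~ cell P `<=` O ->
        (\int[mu]_(x in cell P) (`|nearT1 Q P x| `^ s)%:E <=
           ((kappa * (A * A2) * norm2 Q) `^ s)%:E * mu (cell P))%E)].

(** The degenerate case, where the level would be 0 and the weak type bounds do not apply: [f]
    vanishes almost everywhere on [nine Q], and so do all functions derived from [loc Q]. *)
Lemma exceptional0 Q : norm1 Q = 0 \/ norm2 Q = 0 -> exceptional Q set0.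
Proof.
have s0 : 0 < s := lt_le_trans ltr01 s1.
move=> N0; have f0 : (\int[mu]_(x in cube (nine Q)) `|f x|%:E = 0)%E.
  case: N0 => N0.
    by apply: (LlogL_norm_eq0 b10 (is_cube_nine Q) mf); rewrite norm1E N0.
  by apply: (LlogL_norm_eq0 b20 (is_cube_nine Q) mf); rewrite norm2E N0.
have l0 : ae_Rd (fun x => loc Q x = 0).
  have /(ae_eq_integral_abs mu (mnine Q))[] : measurable_fun (cube (nine Q)) (EFin \o f).
    by apply: measurable_funTS; exact/measurable_EFinP.
  move=> /(_ f0) [N [mN N0' hN]] _; exists N; split => // x /= nl; apply: hN => /= h.
  apply: nl; rewrite /loc indicE; case: (boolP (x \in cube (nine Q))) => [/set_mem/h|_].
    by move=> [->]; rewrite mul0r.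
  by rewrite mulr0.
have T2l0 := lin_op_ae0 lin2 (Lunion_loc Q) l0.
have ge0X (c : R) (X : set Rd) : (0 <= (c `^ s)%:E * mu X)%E.
  by rewrite mule_ge0// lee_fin powR_ge0.
split.
- by move=> x.
- by rewrite measure0 lee_fin divr_ge0// exprn_ge0// ltW// side_gt0.
- move=> X mX _; rewrite (ae0_integral s0 mX (measurable_locT Q))//.
  exact: (lin_op_ae0 lin1 (Lunion_T2loc Q) T2l0).
- move=> P _ _; rewrite (ae0_integral s0 (measurable_cell P) (measurable_farT1 Q P))//.
  apply: (lin_op_ae0 lin1 (Lunion_far1 Q P)); apply: ae_RdW T2l0 => x ->; exact: mul0r.
- move=> P _ _; rewrite (ae0_integral s0 (measurable_cell P) (measurable_nearT1 Q P))//.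
  apply: (lin_op_ae0 lin1 (Lunion_nearT1_arg Q P)).
  have : ae_Rd (fun x => farT2 Q P x = 0).
    apply: (lin_op_ae0 lin2 (Lunion_far2 Q P)); apply: ae_RdW l0 => x ->; exact: mul0r.
  by apply: ae_RdW => x ->; exact: mul0r.
Qed.

Definition bad1 Q lam P : Prop :=
  (lam%:E < ((vol (closed_cell P : Rd * R)) `^ (- s^-1))%:E *
     normp_on s (closed_cell P) (farT1 Q P))%E.

Definition bad2 Q lam P : Prop :=
  (lam%:E < ((vol (three P)) `^ (- s^-1))%:E * normp_on s (three P) (farT2 Q P))%E.

(** This union of cells lies in a superlevel set of [Mop], since the cube attached to a bad cell
    competes in the supremum at every point of that cell. *)
Definition bad_union Q (bad : cellT -> Prop) : set Rd :=
  \bigcup_(P in [set P | cell P `<=` cell Q /\ bad P]) cell P.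

Lemma dopen_bad_union Q bad : dopen (bad_union Q bad).
Proof. by apply: dopen_bigcup => P _; exact: dopen_cell. Qed.

Lemma leb_bad1 Q : 0 < norm1 Q ->
  (leb (bad_union Q (bad1 Q (A1 * (kbig * (2 * norm1 Q))))) <=
    (side Q.1 ^+ d / 2 ^+ d.+4)%:E)%E.
Proof.
move=> N0; have K1 := kbig_ge1.
apply: le_trans (small_modular b10 A1_gt0 N0 (norm1E Q)).
apply: le_trans (weak1 (Lunion_loc Q) _); last by rewrite !mulr_gt0//; lra.
apply: leb_le => x [P [_ bP] Px]; apply: lt_le_trans bP _.
apply: ereal_sup_ubound; exists (closed_cell P) => //.
by split; [exact: is_cube_closed_cell|exact: cell_sub_cube].
Qed.

Lemma leb_bad2 Q : 0 < norm2 Q ->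
  (leb (bad_union Q (bad2 Q (A2 * (kbig * (2 * norm2 Q))))) <=
    (side Q.1 ^+ d / 2 ^+ d.+4)%:E)%E.
Proof.
move=> N0; have K1 := kbig_ge1.
apply: le_trans (small_modular b20 A2_gt0 N0 (norm2E Q)).
apply: le_trans (weak2 (Lunion_loc Q) _); last by rewrite !mulr_gt0//; lra.
apply: leb_le => x [P [_ bP] Px]; apply: lt_le_trans bP _.
apply: ereal_sup_ubound; exists (three P) => //.
by split; [exact: is_cube_three|exact: cell_sub_three].
Qed.

Lemma leb_large Q : 0 < norm1 Q ->
  (leb (cell Q `&` [set x | (A0 * (kbig * (2 * norm1 Q)) < `|locT Q x|)%R]) <=
    (side Q.1 ^+ d / 2 ^+ d.+4)%:E)%E.
Proof.
move=> N0; have K1 := kbig_ge1.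
apply: le_trans (small_modular b10 A0_gt0 N0 (norm1E Q)).
apply: le_trans (weak0 (Lunion_loc Q) _); last by rewrite !mulr_gt0//; lra.
by apply: leb_le => x [].
Qed.

Lemma kappa_bound (a N : R) : 0 <= a -> 0 <= N ->
  (a * (kbig * (2 * N))) * 3 ^+ d = kappa * a * N.
Proof. by move=> *; rewrite /kappa; ring. Qed.

Lemma le_kappa_bound (a N : R) : 0 <= a -> 0 <= N ->
  a * (kbig * (2 * N)) <= kappa * a * N.
Proof.
move=> a0 N0; rewrite -kappa_bound// ler_peMr ?three_pow_ge1//.
by rewrite !mulr_ge0//; have := kbig_ge1; lra.
Qed.

(** As [s] is at least 1, [t] is at most its power; this moves the volume ratio 3^d inside the
    power. *)
Lemma powR_absorb (a l t : R) : 0 <= a -> 0 <= l -> 1 <= t ->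
  a `^ s * l `^ s * t <= (a * l * t) `^ s.
Proof.
move=> a0 l0 t1; have t0 := le_trans ler01 t1.
rewrite powRM ?mulr_ge0// powRM// ler_wpM2l ?mulr_ge0 ?powR_ge0//.
by rewrite -[X in X <= _]powRr1// ler_powR.
Qed.

Lemma exceptional_pos Q : 0 < norm1 Q -> 0 < norm2 Q -> exists O, exceptional Q O.
Proof.
move=> N1 N2; have s0 : 0 < s := lt_le_trans ltr01 s1.
have K1 := kbig_ge1; have mQ := @measurable_cell R d Q.
pose lam0 := A0 * (kbig * (2 * norm1 Q)).
pose lam1 := A1 * (kbig * (2 * norm1 Q)).
pose lam2 := A2 * (kbig * (2 * norm2 Q)).
have l00 : 0 <= lam0 := level_ge0 A0_gt0 (ltW N1).
have l10 : 0 <= lam1 := level_ge0 A1_gt0 (ltW N1).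
have l20 : 0 <= lam2 := level_ge0 A2_gt0 (ltW N2).
pose E0 := cell Q `&` [set x | lam0 < `|locT Q x|].
have mE0 : measurable E0.
  apply: measurableI => //.
  rewrite (_ : [set x | _] = (fun x => `|locT Q x|) @^-1` `]lam0, +oo[%classic).
    rewrite -[X in measurable X]setTI.
    by apply: (measurableT_comp (@normr_measurable R setT) (measurable_locT Q)).
  by apply/seteqP; split => x /=; rewrite in_itv/= andbT.
pose S : R := side Q.1 ^+ d; have S0 : 0 < S by rewrite exprn_gt0// side_gt0.
(* A quarter of the admissible measure: one share for each of the three exceptional sets, and one
   for enlarging [E0] to a dyadic open set. *)
pose q : R := S / 2 ^+ d.+4; have q0 : 0 < q by rewrite divr_gt0// exprn_gt0.
have [ O0 [dO0 EO0 _ lO0]] : exists O0, [/\ dopen O0, E0 `<=` O0, O0 `<=` cell Q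
    & (leb O0 <= leb E0 + q%:E)%E].
  by apply: dyadic_outer_regular => //; move=> x [].
pose O1 := bad_union Q (bad1 Q lam1); pose O2 := bad_union Q (bad2 Q lam2).
have dO1 : dopen O1 by exact: dopen_bad_union.
have dO2 : dopen O2 by exact: dopen_bad_union.
have dU (U V : set Rd) : dopen U -> dopen V -> dopen (U `|` V).
  move=> dU dV x [/dU|/dV] [k h]; exists k => y /h; by [left|right].
exists (O0 `|` O1 `|` O2); split.
- exact: (dU _ _ (dU _ _ dO0 dO1) dO2).
- have m0 := dopen_measurable dO0; have m1 := dopen_measurable dO1.
  have m2 := dopen_measurable dO2.
  apply: le_trans (measureU2 _ (measurableU _ _ m0 m1) m2) _.
  have h01 := measureU2 mu m0 m1.
  have h0 : (leb E0 <= q%:E)%E := leb_large N1.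
  have h1 : (leb O1 <= q%:E)%E := leb_bad1 N1.
  have h2 : (leb O2 <= q%:E)%E := leb_bad2 N2.
  rewrite (_ : side Q.1 ^+ d / 2 ^+ d.+2 = (q + q + q) + q); last first.
    rewrite /q /S !exprS; set p := 2 ^+ d; have p0 : p != 0 by rewrite expf_neq0.
    by field.
  have e0 : (leb O0 <= q%:E + q%:E)%E := le_trans lO0 (leeD h0 (lexx _)).
  have e1 : (leb (O0 `|` O1) <= q%:E + q%:E + q%:E)%E := le_trans h01 (leeD e0 h1).
  rewrite !EFinD; exact: (leeD e1 h2).
- move=> X mX XQ.
  rewrite -(integral_cst mu mX); apply: ge0_le_integral => //.
  + by apply: measurable_funTS; exact: measurable_norm_powR (measurable_locT Q).
  move=> x Xx; rewrite lee_fin ge0_ler_powR ?nnegrE ?(ltW s0)//.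
    exact: (mulr_ge0 (mulr_ge0 (ltW kappa_gt0) (ltW A0_gt0)) (norm1_ge0 Q)).
  apply: le_trans (le_kappa_bound (ltW A0_gt0) (norm1_ge0 Q)).
  have [Qx nOx] := XQ _ Xx; rewrite leNgt; apply/negP => h; apply: nOx.
  by left; left; apply: EO0.
- move=> P PQ PO.
  have nb : ~ bad1 Q lam1 P by move=> bP; apply: PO => x Px; left; right; exists P.
  have {nb} : (((vol (closed_cell P : Rd * R)) `^ (- s^-1))%:E *
     normp_on s (closed_cell P) (farT1 Q P) <= lam1%:E)%E by rewrite leNgt; exact/negP.
  move=> /(not_bad_integral_le s0 l10 (is_cube_closed_cell P)) h.
  apply: (@le_trans _ _ (\int[mu]_(x in cube (closed_cell P)) (`|farT1 Q P x| `^ s)%:E)%E).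
    apply: ge0_subset_integral => //; [exact: measurable_cell|exact: measurable_cube| |].
      by apply: measurable_funTS; exact: measurable_norm_powR (measurable_farT1 Q P).
    exact: cell_sub_cube.
  apply: le_trans h _; rewrite [X in (_ * X)%E]leb_cell -EFinM lee_fin ler_wpM2r//.
    by rewrite exprn_ge0// ltW// side_gt0.
  apply: (ge0_ler_powR (ltW s0)); rewrite ?nnegrE.
  - exact: l10.
  - exact: (mulr_ge0 (mulr_ge0 (ltW kappa_gt0) (ltW A1_gt0)) (norm1_ge0 Q)).
  - exact: (le_kappa_bound (ltW A1_gt0) (norm1_ge0 Q)).
- move=> P PQ PO.
  have nb : ~ bad2 Q lam2 P by move=> bP; apply: PO => x Px; right; exists P.
  have {nb} : (((vol (three P)) `^ (- s^-1))%:E *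
     normp_on s (three P) (farT2 Q P) <= lam2%:E)%E by rewrite leNgt; exact/negP.
  move=> /(not_bad_integral_le s0 l20 (is_cube_three P)) h.
  (* Cutting off to [three P] turns the local bound into one on the global norm, so that [k] is in
     the domain of the strong bound for [T1]. *)
  pose k := fun y => farT2 Q P y * \1_(cube (three P)) y.
  have mk : measurable_fun setT k.
    by apply: measurable_funM; [exact: measurable_farT2|exact: measurable_indic].
  have {}h : (\int[mu]_x (`|k x| `^ s)%:E <= (lam2 `^ s * vol (three P))%:E)%E.
    apply: le_trans h; rewrite [leRHS]integral_mkcond le_eqVlt; apply/orP; left.
    apply/eqP/eq_integral => x _; rewrite patchE /k indicE.
    case: (x \in _); first by rewrite mulr1.
    by rewrite mulr0 normr0 powR0// gt_eqF.
  have Lk : Lp s k by split => //; apply: le_lt_trans h _; rewrite ltry.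
  have := normp_le_integral_le s0 (ltW A_gt0) (strong Lk).
  rewrite -/(nearT1 Q P) => h'.
  apply: (@le_trans _ _ (\int[mu]_x (`|nearT1 Q P x| `^ s)%:E)%E).
    apply: ge0_subset_integral => //; first exact: measurable_cell.
    exact: measurable_norm_powR (measurable_nearT1 Q P).
  apply: le_trans h' _; apply: (@le_trans _ _ ((A `^ s)%:E * (lam2 `^ s * vol (three P))%:E)%E).
    by apply: lee_wpmul2l => //; rewrite lee_fin powR_ge0.
  rewrite [X in (_ <= _ * X)%E]leb_cell -EFinM lee_fin vol_three !mulrA ler_wpM2r//.
    by rewrite exprn_ge0// ltW// side_gt0.
  have -> : kappa * A * A2 * norm2 Q = A * lam2 * 3 ^+ d by rewrite /kappa /lam2; ring.
  exact: (powR_absorb (ltW A_gt0) l20 three_pow_ge1).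
Qed.

Lemma exceptional_exists Q : exists O, exceptional Q O.
Proof.
have := norm1_ge0 Q; rewrite le_eqVlt => /predU1P[/esym N1|N1].
  by exists set0; apply: exceptional0; left.
have := norm2_ge0 Q; rewrite le_eqVlt => /predU1P[/esym N2|N2].
  by exists set0; apply: exceptional0; right.
exact: (exceptional_pos N1 N2).
Qed.

End exceptional_set.

(** * Sparse sums *)

Lemma esumZ_le (R : realType) (T : choiceType) (I : set T) (c : R) (a : T -> \bar R) :
  0 <= c -> (forall i, 0 <= a i)%E ->
  (\esum_(i in I) (c%:E * a i) <= c%:E * \esum_(i in I) a i)%E.
Proof.
move=> c0 a0; apply: ge_ereal_sup => _ [X [finX XI] <-].
rewrite -ge0_mule_fsumr//; apply: lee_wpmul2l; first by rewrite lee_fin.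
by apply: ereal_sup_ubound; exists X.
Qed.

Section sparse_sum.
Context {R : realType} {d : nat}.
Local Notation Rd := (d.-tuple R).
Local Notation cellT := (int * d.-tuple int)%type.
Local Notation cell := (@cell R d).
Local Notation side := (@side R).
Local Notation mu := (@leb R d).
Implicit Types (x y : Rd) (P Q : cellT).

(** The side gives back the level, then the centre gives back the index. So the family may be
    indexed by cells or by cubes. *)
Lemma nine_inj : injective (@nine R d).
Proof.
move=> [k m] [k' m'] e; have e2 : side k = side k'.
  have /(congr1 snd) /= := e; lra.
have kk : k = k'.
  by apply: oppr_inj; apply: (@ieexprIz R 2) e2; rewrite ?ltr0n// pnatr_eq1.
subst k'; congr pair; apply: eq_from_tnth => i.
have /(congr1 (fun t => tnth t.1 i)) := e; rewrite !tnth_mktuple /=.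
move=> /(mulfI (lt0r_neq0 (side_gt0 k))) /addIr; exact: intr_inj.
Qed.

Variables (J : nat) (O : cellT -> set Rd).
Local Notation chain := (chain J O).

(** The default 0 is the value on infinite chains, a null set, and only there, since every chain has
    a top cell. *)
Definition chain_length x : nat :=
  if pselect (exists n, chain n x == None) is left h then ex_minn h else 0%N.

Lemma chain_lengthS n x : chain_length x = n.+1 <-> chain n x <> None /\ chain n.+1 x = None.
Proof.
rewrite /chain_length; case: pselect => [h|nh]; last first.
  split=> // -[_ /eqP h]; exfalso; apply: nh; by exists n.+1.
case: ex_minnP => m /eqP hm minm; split=> [e|[h1 h2]].
  rewrite -e; split => // /eqP /minm; rewrite e; lia.
apply/eqP; rewrite eqn_leq minm ?h2//= ltnNge; apply/negP => mn.
by apply: h1; exact: chain_None mn hm.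
Qed.

Lemma measurable_chain_length n : measurable (chain_length @^-1` [set n]).
Proof.
have mS k : measurable (chain_length @^-1` [set k.+1]).
  rewrite (_ : _ @^-1` _ = (~` (chain k @^-1` [set None])) `&` chain k.+1 @^-1` [set None]).
    by apply: measurableI; [apply: measurableC|]; exact: measurable_chain.
  by apply/seteqP; split => x /chain_lengthS.
case: n => [|n]; last exact: mS.
rewrite (_ : _ @^-1` _ = ~` \bigcup_k (chain_length @^-1` [set k.+1])).
  by apply: measurableC; exact: bigcupT_measurable.
apply/seteqP; split => x /= => [h [k _ /=]|h]; first by rewrite h.
by case E : (chain_length x) => [//|k]; exfalso; apply: h; exists k.
Qed.

Definition chain_sum (a : nat -> Rd -> R) x : R := \sum_(i < chain_length x) a i x.

Lemma measurable_chain_sum a : (forall n, measurable_fun setT (a n)) ->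
  measurable_fun setT (chain_sum a).
Proof.
move=> ma; apply: (measurable_fun_glue measurable_chain_length
  (f := fun n x => \sum_(i < n) a i x)) => n.
by apply: measurable_sum.
Qed.

(** The finite chain sum is dominated by the full series over generations. Each generation is
    integrated cell by cell, and the resulting sum over pairs of a generation and a cell becomes a
    sum over cubes by [nine_inj] and [chain_index_inj]. *)
Lemma sparse_sum_le (beta r c : R) (f g : Rd -> R) (a : nat -> Rd -> R) : 0 <= c ->
  (forall n, measurable_fun setT (a n)) -> measurable_fun setT g ->
  (forall n x, chain n x = None -> a n x = 0) ->
  (forall n x Q, chain n x = Some Q ->
     (\int[mu]_(x in cell Q) `|a n x * g x|%:E <=
      c%:E * ((vol (nine Q))%:E * LlogL_norm beta f (nine Q) * avg_r r g (nine Q)))%E) ->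
  (`| \int[mu]_x (chain_sum a x * g x)%:E | <=
   c%:E * sparse_form beta r [set nine Q | Q in in_chain J O] f g)%E.
Proof.
move=> c0 ma mg aN ha.
have mag n : measurable_fun setT (fun x => `|a n x * g x|%:E).
  by apply/measurable_EFinP; apply: measurableT_comp => //; exact: measurable_funM.
have mH := measurable_chain_sum ma.
apply: le_trans (le_abse_integral mu measurableT _) _.
  by apply/measurable_EFinP; exact: measurable_funM.
apply: (@le_trans _ _ (\int[mu]_x (\sum_(n <oo) `|a n x * g x|%:E))%E).
  apply: ge0_le_integral => //.
  - by apply: measurableT_comp => //; apply/measurable_EFinP; exact: measurable_funM.
  - by apply: ge0_emeasurable_sum.
  move=> x _; rewrite /chain_sum /= mulr_suml.
  apply: (@le_trans _ _ (\sum_(0 <= i < chain_length x) `|a i x * g x|%:E)%E).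
    by rewrite big_mkord sumEFin lee_fin ler_norm_sum.
  exact: nneseries_lim_ge.
rewrite integral_nneseries//.
pose tau (Q : Rd * R) := ((vol Q)%:E * LlogL_norm beta f Q * avg_r r g Q)%E.
have vol0 (Q : Rd * R) : (0 <= vol Q)%R -> (0 <= tau Q)%E.
  by move=> v0; rewrite !mule_ge0 ?lee_fin ?LlogL_norm_ge0 ?poweR_ge0.
have tau0 Q : (0 <= tau (nine Q))%E.
  by apply: vol0; apply: ltW; apply: vol_gt0; exact: is_cube_nine.
pose F n := [set Q | exists x, chain n x = Some Q].
apply: (@le_trans _ _ (\sum_(n <oo) \esum_(Q in F n) (c%:E * tau (nine Q)))%E).
  apply: lee_nneseries => n *; first exact: integral_ge0.
  rewrite (ge0_integral_esum_fibers (c := chain n))//; last 2 first.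
    exact: measurable_chain.
    by move=> x /aN ->; rewrite mul0r normr0.
  apply: le_esum => Q [x hx]; rewrite (chain_fiber hx); exact: ha hx.
rewrite nneseries_esumT; last first.
  by move=> n; apply: esum_ge0 => Q _; rewrite mule_ge0// lee_fin.
rewrite esum_esum; last by move=> *; rewrite mule_ge0// lee_fin.
apply: (@le_trans _ _ (c%:E * \esum_(k in [set: nat] `*`` F) tau (nine k.2))%E).
  exact: esumZ_le.
apply: lee_wpmul2l; first by rewrite lee_fin.
rewrite /sparse_form (@reindex_esum _ _ _ ([set: nat] `*`` F) _
  (fun k : nat * cellT => nine k.2))//; split.
- by move=> [n Q] [_ [x hx]]; exists Q => //; exists n, x.
- move=> [n Q] [m P] /set_mem[_ [x hx]] /set_mem[_ [y hy]] /= /nine_inj e.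
  by rewrite /= -e in hx hy *; rewrite (chain_index_inj hx hy).
- by move=> _ [Q [n [x hx]] <-]; exists (n, Q) => //; split => //; exists x.
Qed.

End sparse_sum.

(** * Assembly *)

Section sparse_family.
Context {R : realType} {d : nat}.
Local Notation Rd := (d.-tuple R).
Local Notation cellT := (int * d.-tuple int)%type.
Local Notation cell := (@cell R d).
Local Notation side := (@side R).
Local Notation mu := (@leb R d).
Implicit Types (x y : Rd) (P Q : cellT).
Variables (J : nat) (O : cellT -> set Rd).
Hypothesis Oopen : forall Q, dopen (O Q).
Hypothesis Osmall : forall Q, (leb (O Q) <= (side Q.1 ^+ d / 2 ^+ d.+2)%:E)%E.

Lemma sparse_chain :
  sparse (1 / 2 / (9 ^+ d)) [set @nine R d Q | Q in in_chain J O].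
Proof.
split=> [_ [Q _ <-]|]; first exact: is_cube_nine.
pose last_part Q := cell Q `&` next_cell O Q @^-1` [set None].
(* The set is the part of [Q] missed by its stopping cells. The union over the cells with
   [nine Q = S] inverts [nine]; it has a single member. *)
exists (fun S => \bigcup_(Q in [set Q | in_chain J O Q /\ nine Q = S]) last_part Q).
have EE Q : in_chain J O Q ->
    \bigcup_(P in [set P | in_chain J O P /\ nine P = nine Q :> Rd * R]) last_part P = last_part Q.
  move=> cQ; apply/seteqP; split => [x [P [_ /nine_inj ->]]//|x Qx].
  by exists Q.
split=> [_ [Q cQ <-]|_ _ [P cP <-] [Q cQ <-] PQ]; last first.
  rewrite !EE//; apply: (in_chain_last_disjoint cP cQ) => e; apply: PQ; by rewrite e.
rewrite EE//; have mQ := @measurable_cell R d Q.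
have mN := measurable_next O Q None.
have mL : measurable (last_part Q) by exact: measurableI.
split => //; first by move=> x [/cell_sub_nine].
have mS : measurable (cell Q `&` [set x | next_cell O Q x <> None]).
  by apply: measurableI => //; exact: (fiber_measurable (measurable_next O Q) [set t | t <> None]).
have S0 : 0 < side Q.1 ^+ d by rewrite exprn_gt0// side_gt0.
have h : (leb (cell Q) <= leb (last_part Q) + leb (cell Q `&` [set x | next_cell O Q x <> None]))%E.
  apply: le_trans (measureU2 _ mL mS); apply: leb_le => x Qx.
  by have [e|e] := pselect (next_cell O Q x = None); [left|right].
have h2 := leb_next_le Oopen Osmall Q.
have {h h2} : (leb (cell Q) <= leb (last_part Q) + (side Q.1 ^+ d / 2)%:E)%E.
  by apply: le_trans h _; apply: leeD.
rewrite leb_cell -leeBlDr// -EFinB; apply: le_trans.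
rewrite lee_fin vol_nine.
have u0 : 9 ^+ d != 0 :> R by rewrite expf_neq0.
have -> : 1 / 2 / 9 ^+ d * (9 ^+ d * side Q.1 ^+ d) = side Q.1 ^+ d / 2 by field.
lra.
Qed.

End sparse_family.

(** * Estimates of the terms and the telescoping identity *)

Section assembly.
Context {R : realType} {d : nat}.
Local Notation Rd := (d.-tuple R).
Local Notation cellT := (int * d.-tuple int)%type.
Local Notation cell := (@cell R d).
Local Notation side := (@side R).
Local Notation mu := (@leb R d).
Implicit Types (x y : Rd) (P Q : cellT).
Variables (T1 T2 : (Rd -> R) -> (Rd -> R)) (f : Rd -> R).
Variables (r s beta1 beta2 C0 A A0 A1 A2 : R) (J : nat).
Hypotheses (r0 : 0 < r) (s1 : 1 <= s) (rs : r^-1 + s^-1 = 1).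
Hypotheses (b10 : 0 <= beta1) (b20 : 0 <= beta2) (C00 : 0 < C0).
Hypotheses (A_gt0 : 0 < A) (A0_gt0 : 0 < A0) (A1_gt0 : 0 < A1) (A2_gt0 : 0 < A2).
Hypotheses (lin1 : lin_op T1) (lin2 : lin_op T2).
Hypothesis L2 : forall h, Lunion h -> Lunion (T2 h).
Hypotheses (mf : measurable_fun setT f) (bf : exists M : R, forall x, `|f x| <= M).
Hypothesis suppf : forall x, f x != 0 -> forall i, `|tnth x i| <= 2 ^+ J.
Variable O : cellT -> set Rd.
Hypothesis hO : forall Q, exceptional T1 T2 f s beta1 beta2 C0 A A0 A1 A2 Q (O Q).

Local Notation chain := (chain J O).
Local Notation next_cell := (next_cell O).
Local Notation locT := (locT T1 T2 f).
Local Notation farT1 := (farT1 T1 T2 f).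
Local Notation nearT1 := (nearT1 T1 T2 f).
Local Notation norm1 := (norm1 f beta1).
Local Notation norm2 := (norm2 f beta2).
Local Notation kappa := (@kappa R d C0).

Let Oopen Q : dopen (O Q). Proof. by have [] := hO Q. Qed.
Let Osmall Q : (leb (O Q) <= (side Q.1 ^+ d / 2 ^+ d.+2)%:E)%E.
Proof. by have [] := hO Q. Qed.
Let s0 : 0 < s. Proof. exact: lt_le_trans s1. Qed.

Let mfar Q P : measurable_fun setT (farT1 Q P).
Proof. exact: (measurable_farT1 lin1 L2 mf bf). Qed.
Let mnear Q P : measurable_fun setT (nearT1 Q P).
Proof. exact: (measurable_nearT1 lin1 L2 mf bf). Qed.
Let mloc Q : measurable_fun setT (locT Q).
Proof. exact: (measurable_locT lin1 L2 mf bf). Qed.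

Definition main_part Q x : R := if next_cell Q x is Some P then farT1 Q P x else locT Q x.
Definition tail_part Q x : R := if next_cell Q x is Some P then nearT1 Q P x else 0.

Lemma measurable_main_part Q : measurable_fun setT (main_part Q).
Proof.
apply: (measurable_fun_glue (measurable_next O Q)
  (f := fun t x => if t is Some P then farT1 Q P x else locT Q x)) => -[P|].
  exact: mfar.
exact: mloc.
Qed.

Lemma measurable_tail_part Q : measurable_fun setT (tail_part Q).
Proof.
apply: (measurable_fun_glue (measurable_next O Q)
  (f := fun t x => if t is Some P then nearT1 Q P x else 0)) => -[P|//].
exact: mnear.
Qed.

Lemma leb_cell_nine Q : (side Q.1 ^+ d <= vol (@nine R d Q)).
Proof.
rewrite vol_nine ler_peMl ?exprn_ege1//; last by lra.
by rewrite exprn_ge0// ltW// side_gt0.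
Qed.

(** On [cell Q] the fibres of [next_cell] are stopping cells, which are not contained in [O Q], and
    a remainder, which avoids [O Q]: exactly the sets for which [exceptional] gives bounds. *)
Lemma integral_next_le Q (w : Rd -> R) (W : option cellT -> Rd -> R) (lam : R) : 0 <= lam ->
  (forall t, measurable_fun setT (W t)) -> (forall x, w x = W (next_cell Q x) x) ->
  (forall P, cell P `<=` cell Q -> ~ cell P `<=` O Q ->
     (\int[mu]_(x in cell P) (`|W (Some P) x| `^ s)%:E <= (lam `^ s)%:E * mu (cell P))%E) ->
  (forall X, measurable X -> X `<=` cell Q `\` O Q ->
     (\int[mu]_(x in X) (`|W None x| `^ s)%:E <= (lam `^ s)%:E * mu X)%E) ->
  (\int[mu]_(x in cell Q) (`|w x| `^ s)%:E <= (lam `^ s * vol (nine Q))%:E)%E.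
Proof.
move=> lam0 mW wW hP hX; have mQ := @measurable_cell R d Q.
have mw : measurable_fun setT w.
  rewrite (_ : w = fun x => W (next_cell Q x) x); last exact/funext.
  exact: (measurable_fun_glue (measurable_next O Q) (f := W) mW).
apply: (@le_trans _ _ ((lam `^ s)%:E * mu (cell Q))%E); last first.
  rewrite [X in (_ * X)%E]leb_cell -EFinM lee_fin; apply: ler_wpM2l; first exact: powR_ge0.
  exact: leb_cell_nine.
rewrite -(integral_cst mu mQ); apply: (le_integral_fibers (measurable_next O Q)) => //.
- exact: (measurable_norm_powR s mw).
- by move=> x; rewrite lee_fin powR_ge0.
move=> t; have mt := measurable_next O Q t; rewrite integral_cst; last exact: measurableI.
have e0 (X : set Rd) : (forall x, X x -> next_cell Q x = t) ->
    (\int[mu]_(x in X) (`|w x| `^ s)%:E = \int[mu]_(x in X) (`|W t x| `^ s)%:E)%E.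
  by move=> Xt; apply: eq_integral => x /set_mem/Xt xt; rewrite wW xt.
rewrite e0; last by move=> x [].
case: t mt {e0} => [P|] mt; last first.
  apply: hX; first exact: measurableI.
  by move=> x [Qx nx]; split => //; exact: (next_None_notin Oopen Qx nx).
have [[x [Qx h]]|nh] := pselect (exists x, cell Q x /\ next_cell Q x = Some P); last first.
  rewrite (_ : _ `&` _ = set0).
    by rewrite integral_set0 measure0 mule0.
  by apply/seteqP; split => // x [Qx h]; apply: nh; exists x.
have sub := next_sub Qx h.
rewrite (next_fiber h) (_ : cell Q `&` cell P = cell P); last exact/setIidPr.
by apply: hP => //; exact: (next_not_sub Osmall h).
Qed.

Let level1 Q : R := kappa * (A0 + A1) * norm1 Q.
Let level2 Q : R := kappa * (A * A2) * norm2 Q.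

Let kappa0 : 0 < kappa. Proof. exact: (kappa_gt0 C00). Qed.

Let mul_levels (a b c : R) (X : \bar R) : 0 <= a -> a <= b -> 0 <= c -> (0 <= X)%E ->
  (((kappa * a * c) `^ s)%:E * X <= ((kappa * b * c) `^ s)%:E * X)%E.
Proof.
move=> a0 ab c0 X0; apply: lee_wpmul2r => //; rewrite lee_fin.
have b0 := le_trans a0 ab.
have m z : 0 <= z -> 0 <= kappa * z * c.
  by move=> z0; exact: (mulr_ge0 (mulr_ge0 (ltW kappa0) z0) c0).
apply: (ge0_ler_powR (ltW s0)); rewrite ?nnegrE; [exact: (m _ a0)|exact: (m _ b0)|].
exact: (ler_wpM2r c0 (ler_wpM2l (ltW kappa0) ab)).
Qed.

Let level1_ge0 Q : 0 <= level1 Q.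
Proof.
exact: (mulr_ge0 (mulr_ge0 (ltW kappa0) (addr_ge0 (ltW A0_gt0) (ltW A1_gt0)))
  (norm1_ge0 f beta1 Q)).
Qed.

Let level2_ge0 Q : 0 <= level2 Q.
Proof.
exact: (mulr_ge0 (mulr_ge0 (ltW kappa0) (mulr_ge0 (ltW A_gt0) (ltW A2_gt0)))
  (norm2_ge0 f beta2 Q)).
Qed.

Lemma farT1_le Q P : cell P `<=` cell Q -> ~ cell P `<=` O Q ->
  (\int[mu]_(x in cell P) (`|farT1 Q P x| `^ s)%:E <= (level1 Q `^ s)%:E * mu (cell P))%E.
Proof.
have [_ _ _ h _] := hO Q => PQ PO; apply: le_trans (h P PQ PO) _.
apply: (mul_levels (ltW A1_gt0) _ (norm1_ge0 f beta1 Q) (measure_ge0 _ _)).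
by rewrite lerDr ltW.
Qed.

Lemma main_part_le Q :
  (\int[mu]_(x in cell Q) (`|main_part Q x| `^ s)%:E <= (level1 Q `^ s * vol (nine Q))%:E)%E.
Proof.
apply: (@integral_next_le Q _ (fun t x => if t is Some P then farT1 Q P x else locT Q x)
  (level1 Q) (level1_ge0 Q)); [|by []| |].
- by move=> [P|]; [exact: mfar|exact: mloc].
- exact: (@farT1_le Q).
- have [_ _ h _ _] := hO Q => X mX XQ; apply: le_trans (h X mX XQ) _.
  apply: (mul_levels (ltW A0_gt0) _ (norm1_ge0 f beta1 Q) (measure_ge0 _ _)).
  by rewrite lerDl ltW.
Qed.

Lemma tail_part_le Q :
  (\int[mu]_(x in cell Q) (`|tail_part Q x| `^ s)%:E <= (level2 Q `^ s * vol (nine Q))%:E)%E.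
Proof.
apply: (@integral_next_le Q _ (fun t x => if t is Some P then nearT1 Q P x else 0)
  (level2 Q) (level2_ge0 Q)); [|by []| |].
- by move=> [P|//]; exact: mnear.
- by have [_ _ _ _ h] := hO Q.
- move=> X mX _; under eq_integral do rewrite normr0 powR0 ?gt_eqF//.
  by rewrite integral0 mule_ge0// lee_fin powR_ge0.
Qed.

(** [Q] itself is an admissible subcell, because [O Q] is too small to contain it. *)
Lemma far_self_le Q :
  (\int[mu]_(x in cell Q) (`|farT1 Q Q x| `^ s)%:E <= (level1 Q `^ s * vol (nine Q))%:E)%E.
Proof.
have nsub : ~ cell Q `<=` O Q by apply: not_sub_O; exact: Osmall.
apply: (le_trans (@farT1_le Q Q (fun x Qx => Qx) nsub)).
rewrite [X in (_ * X)%E]leb_cell -EFinM lee_fin; apply: ler_wpM2l; first exact: powR_ge0.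
exact: leb_cell_nine.
Qed.

(** The subtracted term of the decomposition for a pair of consecutive cells is charged to the
    smaller one, so that generation [n] involves the norm on one cube only. A top cell has no
    predecessor, hence the factor that vanishes for [n = 0]. *)
Definition main_term n x : R := if chain n x is Some Q
  then main_part Q x - (0 < n)%N%:R * farT1 Q Q x else 0.
Definition tail_term n x : R := if chain n x is Some Q then tail_part Q x else 0.

Lemma measurable_main_term n : measurable_fun setT (main_term n).
Proof.
apply: (measurable_fun_glue (measurable_chain J O n)
  (f := fun t x => if t is Some Q then main_part Q x - (0 < n)%N%:R * farT1 Q Q x else 0)).
case=> [Q|//]; apply: measurable_funB; first exact: measurable_main_part.
by apply: measurable_funM => //; exact: mfar.
Qed.

Lemma measurable_tail_term n : measurable_fun setT (tail_term n).
Proof.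
apply: (measurable_fun_glue (measurable_chain J O n)
  (f := fun t x => if t is Some Q then tail_part Q x else 0)).
by case=> [Q|//]; exact: measurable_tail_part.
Qed.

Lemma main_term_le n x Q g : chain n x = Some Q -> measurable_fun setT g ->
  (\int[mu]_(x in cell Q) `|main_term n x * g x|%:E <= (2 * kappa * (A0 + A1))%:E *
     ((vol (nine Q))%:E * LlogL_norm beta1 f (nine Q) * avg_r r g (nine Q)))%E.
Proof.
move=> hx mg; have mQ := @measurable_cell R d Q.
have mM := measurable_main_part Q.
have mF : measurable_fun setT (farT1 Q Q) by exact: mfar.
have mabs (h : Rd -> R) : measurable_fun setT h ->
    measurable_fun (cell Q) (fun x => `|h x * g x|%:E).
  move=> mh; apply: measurable_funTS; apply/measurable_EFinP.
  by apply: measurableT_comp => //; exact: measurable_funM.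
have nQ := is_cube_nine (R := R) Q; have sub := @cell_sub_nine R d Q.
have b1 := hoelder_sparse_term mQ nQ sub mM mg r0 s0 rs (level1_ge0 Q) (main_part_le Q).
have b2 := hoelder_sparse_term mQ nQ sub mF mg r0 s0 rs (level1_ge0 Q) (far_self_le Q).
apply: (@le_trans _ _ (\int[mu]_(x in cell Q)
    (`|main_part Q x * g x|%:E + `|farT1 Q Q x * g x|%:E))%E).
  apply: ge0_le_integral => //.
  - exact: mabs (measurable_main_term n).
  - by apply: emeasurable_funD; exact: mabs.
  move=> y Qy; rewrite -EFinD lee_fin /main_term (chain_const hx Qy) mulrBl.
  apply: le_trans (ler_normB _ _) _; rewrite lerD2l -mulrA normrM ler_piMl//.
  by case: (0 < n)%N; rewrite ?normr1 ?normr0.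
rewrite ge0_integralD//; [|exact: mabs|exact: mabs].
apply: le_trans (leeD b1 b2) _; rewrite (norm1E b10 mf bf).
set X := avg_r _ _ _; have X0 : (0 <= X)%E by exact: poweR_ge0.
have v0 : 0 <= vol (@nine R d Q) by exact/ltW/vol_gt0.
have lv0 : 0 <= level1 Q * vol (@nine R d Q) := mulr_ge0 (level1_ge0 Q) v0.
rewrite !muleA -!EFinM -ge0_muleDl ?lee_fin//.
have e (v : R) : level1 Q * v + level1 Q * v = 2 * kappa * (A0 + A1) * (v * norm1 Q).
  by rewrite /level1; ring.
by rewrite -EFinD e mulrA lexx.
Qed.

(** The factor 2 is slack, giving both estimates the same constant. *)
Lemma tail_term_le n x Q g : chain n x = Some Q -> measurable_fun setT g ->
  (\int[mu]_(x in cell Q) `|tail_term n x * g x|%:E <= (2 * kappa * (A * A2))%:E *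
     ((vol (nine Q))%:E * LlogL_norm beta2 f (nine Q) * avg_r r g (nine Q)))%E.
Proof.
move=> hx mg; have mQ := @measurable_cell R d Q.
have mM := measurable_tail_part Q.
have nQ := is_cube_nine (R := R) Q; have sub := @cell_sub_nine R d Q.
have b1 := hoelder_sparse_term mQ nQ sub mM mg r0 s0 rs (level2_ge0 Q) (tail_part_le Q).
rewrite (eq_integral (fun x => `|tail_part Q x * g x|%:E)); last first.
  by move=> y /set_mem Qy; rewrite /tail_term (chain_const hx Qy).
apply: le_trans b1 _; rewrite (norm2E b20 mf bf).
set X := avg_r _ _ _; have X0 : (0 <= X)%E by exact: poweR_ge0.
have v0 : 0 <= vol (@nine R d Q) by exact/ltW/vol_gt0.
rewrite !muleA -!EFinM; apply: lee_wpmul2r => //; rewrite lee_fin /level2.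
have := mulr_ge0 (level2_ge0 Q) v0; rewrite /level2; set a := _ * vol _ => a0.
rewrite [leRHS](_ : _ = 2 * a); [lra|rewrite /a; ring].
Qed.

Lemma telescope x :
  (forall P Q, cell P `<=` cell Q ->
     locT Q x = farT1 Q P x - farT1 P P x + nearT1 Q P x + locT P x) ->
  ~ infinite_chain J O x ->
  T1 (T2 f) x = chain_sum J O main_term x + chain_sum J O tail_term x.
Proof.
move=> id fin.
(* The remainder after [n] steps is [locT Q] minus the far term still to be charged to [Q]. At the
   last cell of the chain this is exactly [main_term], and [tail_term] is 0. *)
have partial n Q : chain n x = Some Q -> T1 (T2 f) x =
    \sum_(i < n) (main_term i x + tail_term i x) + (locT Q x - (0 < n)%N%:R * farT1 Q Q x).
  elim: n Q => [|n IH] Q.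
    move=> [<-]; rewrite big_ord0 mul0r subr0 add0r /locT; congr (T1 (T2 _) x).
    apply/funext => y; rewrite /loc indicE.
    have [->|fy] := eqVneq (f y) 0; first by rewrite mul0r.
    rewrite mem_set ?mulr1// /nine /three /dil3 /= mulrA (_ : 3 * 3 = 9 :> R); last by lra.
    by apply: top_dilate; exact: suppf.
  move=> /=; case E : (chain n x) => [P|//] /= hQ.
  have PQ := next_sub (chain_mem E) hQ.
  have e1 : main_term n x = farT1 P Q x - (0 < n)%N%:R * farT1 P P x.
    by rewrite /main_term E /main_part hQ.
  have e2 : tail_term n x = nearT1 P Q x by rewrite /tail_term E /tail_part hQ.
  rewrite (IH _ E) big_ord_recr /= e1 e2 (id _ _ PQ); ring.
have [n hn] : exists n, chain n x = None.
  by apply: contrapT => nh; apply: fin => n _ /= hn; apply: nh; exists n.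
(* Length 0 is excluded: the chain is finite and its index 0 is never [None]. *)
case E : (chain_length J O x) => [|m].
  move: E; rewrite /chain_length; case: pselect => [h|nh]; last first.
    by exfalso; apply: nh; exists n; apply/eqP.
  by case: ex_minnP => k /eqP + _ e; rewrite e.
have /chain_lengthS[hm hm1] := E.
rewrite /chain_sum E -big_split /=.
case Em : (chain m x) hm => [Q|//] _.
have nN : next_cell Q x = None by move: hm1; rewrite /= Em.
have e1 : main_term m x = locT Q x - (0 < m)%N%:R * farT1 Q Q x.
  by rewrite /main_term Em /main_part nN.
have e2 : tail_term m x = 0 by rewrite /tail_term Em /tail_part nN.
by rewrite (partial _ _ Em) big_ord_recr /= e1 e2 addr0.
Qed.

(** The decomposition fails on a null set for each pair of cells, and there are countably many
    pairs, so outside one null set it holds for all of them. *)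
Lemma ae_telescope :
  ae_Rd (fun x => T1 (T2 f) x = chain_sum J O main_term x + chain_sum J O tail_term x).
Proof.
pose bad (n : nat) : set Rd := if unpickle n is Some (P, Q) then
  [set x | cell P `<=` cell Q /\
     locT Q x <> farT1 Q P x - farT1 P P x + nearT1 Q P x + locT P x] else set0.
have nbad : (@leb R d).-negligible (\bigcup_n bad n).
  apply: negligible_bigcup => n; rewrite /bad; case: unpickle => [[P Q]|]; last first.
    exact: (negligible_set0 _).
  have [PQ|nPQ] := pselect (cell P `<=` cell Q); last first.
    by apply: (negligibleS _ (negligible_set0 _)) => x [].
  by apply: (negligibleS _ (@locT_split R d T1 T2 f lin1 lin2 L2 mf bf Q P PQ)) => x [].
have ninf : (@leb R d).-negligible (infinite_chain J O).
  exists (infinite_chain J O); split => //; first exact: measurable_infinite_chain.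
  exact: leb_infinite_chain.
apply: (negligibleS _ (negligibleU ninf nbad)) => x /= nx.
apply: contrapT => h; apply: nx.
apply: telescope => [P Q PQ|]; last by move=> ix; apply: h; left.
apply: contrapT => ne; apply: h; right.
have bx : bad (pickle (P, Q)) x by rewrite /bad pickleK.
exact: (ex_intro2 _ _ (pickle (P, Q)) I bx).
Qed.

End assembly.

Lemma bdd_cpt_window (R : realType) (d : nat) (f : d.-tuple R -> R) : bdd_cpt f ->
  exists J : nat, forall x, f x != 0 -> forall i, `|tnth x i| <= 2 ^+ J.
Proof.
move=> [_ _ [Q [Q0 fQ]]].
exists (Num.bound (\sum_i `|tnth Q.1 i| + Q.2)) => x /fQ Qx i.
apply: (@le_trans _ _ (\sum_i `|tnth Q.1 i| + Q.2)); last first.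
  by apply: ltW; exact: upper_nthrootP.
have : `|tnth Q.1 i| <= \sum_j `|tnth Q.1 j|.
  by rewrite (bigD1 i)//= lerDl sumr_ge0.
have := Qx i; move: Q0; rewrite /is_cube.
have := ler_normD (tnth x i - tnth Q.1 i) (tnth Q.1 i); rewrite subrK.
lra.
Qed.

Theorem theorem4p2 (R : realType) (d : nat) (r beta1 beta2 gamma C0 : R) :
  (0 < d)%N -> 1 < r <= 3 / 2 -> 0 <= beta1 -> 0 <= beta2 -> 0 <= gamma ->
  0 < C0 ->
  exists C : R, 0 < C /\
  forall (T1 T2 : (d.-tuple R -> R) -> (d.-tuple R -> R)) (A A0 A1 A2 : R),
    0 < A -> 0 < A0 -> 0 < A1 -> 0 < A2 ->
    lin_op T1 -> lin_op T2 -> (forall f, Lunion f -> Lunion (T2 f)) ->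
    (* (i) *)
    (forall f, Lp (r / (r - 1)) f ->
       (normp (r / (r - 1)) (T1 f) <= A%:E * normp (r / (r - 1)) f)%E) ->
    (* (ii) *)
    (forall f (lam : R), Lunion f -> 0 < lam ->
       (@leb R d [set x | (lam < `|T1 (T2 f) x|)%R] <= C0%:E * modular beta1 A0 lam f)%E) ->
    (* (iii) *)
    (forall f (lam : R), Lunion f -> 0 < lam ->
       (@leb R d [set x | lam%:E < Mop T1 (r / (r - 1)) (T2 f) x]
          <= C0%:E * modular beta1 A1 lam f)%E) ->
    (forall f (lam : R), Lunion f -> 0 < lam ->
       (@leb R d [set x | lam%:E < Mop T2 (r / (r - 1)) f x]
          <= C0%:E * modular beta2 A2 lam f)%E) ->
    forall f, bdd_cpt f ->
    exists (S : set (d.-tuple R * R)) (H1 H2 : d.-tuple R -> R),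
      [/\ sparse (1 / 2 / (9 ^+ d)) S,
          measurable_fun setT H1 /\ measurable_fun setT H2,
          (forall g, measurable_fun setT g ->
             (`| \int[@leb R d]_x (H1 x * g x)%:E |
                <= (C * (A0 + A1))%:E * sparse_form beta1 r S f g)%E),
          (forall g, measurable_fun setT g ->
             (`| \int[@leb R d]_x (H2 x * g x)%:E |
                <= (C * (A * A2))%:E * sparse_form beta2 r S f g)%E)
        & ae_Rd (fun x => T1 (T2 f) x = H1 x + H2 x)].
Proof.
move=> _ /andP[r1 _] b10 b20 _ C00.
have k0 : 0 < @kappa R d C0 := kappa_gt0 C00.
(* This depends only on [d] and [C0]; the factor 2 accounts for the two pieces of [main_term]. *)
exists (2 * @kappa R d C0); split; first exact: mulr_gt0.
move=> T1 T2 A A0 A1 A2 A_gt0 A0_gt0 A1_gt0 A2_gt0 lin1 lin2 L2.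
have r0 : 0 < r by lra.
have rn0 : r != 0 by rewrite gt_eqF.
have r1n0 : r - 1 != 0 by rewrite subr_eq0 gt_eqF.
have s1 : 1 <= r / (r - 1) by rewrite ler_pdivlMr; lra.
have rs : r^-1 + (r / (r - 1))^-1 = 1 by field; rewrite rn0 r1n0.
move: (r / (r - 1)) s1 rs => s s1 rs strong weak0 weak1 weak2 f cf.
have [J suppf] := bdd_cpt_window cf; have [mf bf _] := cf.
have /choice[ O hO] := exceptional_exists s1 b10 b20 C00 A_gt0 A0_gt0 A1_gt0 A2_gt0
  lin1 lin2 L2 strong weak0 weak1 weak2 mf bf.
have Oopen Q : dopen (O Q) by have [] := hO Q.
have Osmall Q : (leb (O Q) <= (@side R Q.1 ^+ d / 2 ^+ d.+2)%:E)%E by have [] := hO Q.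
have ma1 := measurable_main_term J lin1 L2 mf bf O.
have ma2 := measurable_tail_term J lin1 L2 mf bf O.
exists [set nine Q | Q in in_chain J O],
  (chain_sum J O (main_term T1 T2 f J O)), (chain_sum J O (tail_term T1 T2 f J O)); split.
- exact: (sparse_chain J Oopen Osmall).
- by split; apply: measurable_chain_sum.
- move=> g mg; apply: (sparse_sum_le _ ma1 mg).
  + by rewrite ltW// mulr_gt0 ?addr_gt0// mulr_gt0.
  + by move=> n x hx; rewrite /main_term hx.
  + move=> n x Q hx.
    exact: (main_term_le r0 s1 rs b10 C00 A0_gt0 A1_gt0 lin1 L2 mf bf hO hx mg).
- move=> g mg; apply: (sparse_sum_le _ ma2 mg).
  + by rewrite ltW// mulr_gt0 ?(mulr_gt0 A_gt0 A2_gt0)// mulr_gt0.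
  + by move=> n x hx; rewrite /tail_term hx.
  + move=> n x Q hx.
    exact: (tail_term_le r0 s1 rs b20 C00 A_gt0 A2_gt0 lin1 L2 mf bf hO hx mg).
- exact: (ae_telescope lin1 lin2 L2 mf bf suppf hO).
Qed.
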